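(* Let $G$ be a locally compact group. Then $G$ is compact if any one of the following conditions holds: (1) there exists a measure $\mu \in \mathrm{Soc}(L^1(G))$ such that $\mu(G) \neq 0$; (2) there exists a measure $\mu \in \mathrm{Soc}(M(G))$ such that $\mu(G) \neq 0$; (3) $G$ is an abelian group and $\mathrm{Soc}(L^1(G)) \neq 0$.
   Context: For a locally compact group $G$, $L^1(G)$ denotes its group algebra (with convolution) and $M(G)$ its usual measure algebra (with convolution). $L^1(G)$ is regarded as a subalgebra (an ideal) of $M(G)$, so its elements are regarded as measures on $G$; in particular, for $\mu \in L^1(G)$, $\mu(G)$ is the integral of $\mu$ over $G$ with respect to the chosen Haar measure. For a Banach algebra $A$, $\mathrm{Soc}(A)$ denotes the left socle of $A$: if $A$ has minimal left ideals, it is the smallest left ideal of $A$ containing all of them (i.e. their sum); if $A$ has no minimal left ideals, $\mathrm{Soc}(A) = (0)$. *)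

(* Defs.v *)
From HB Require Import structures.
From mathcomp Require Import all_boot all_order all_algebra.
From mathcomp Require Import complex.
From mathcomp Require Import all_classical all_reals all_analysis.

Set Implicit Arguments.
Unset Strict Implicit.
Unset Printing Implicit Defensive.

Import Order.TTheory GRing.Theory Num.Theory.
Import numFieldNormedType.Exports.

Local Open Scope classical_set_scope.
Local Open Scope ring_scope.

HB.mixin Record isTopologicalGroup G of Group G & Topological G := {
  mulg_continuous : continuous (fun xy : G * G => (xy.1 * xy.2)%g) ;
  invg_continuous : continuous (fun x : G => (x^-1)%g)
}.

#[short(type="topologicalGroupType")]
HB.structure Definition TopologicalGroup :=
  (* The base point carries no hypothesis; measurable types need one. *)
  {G of Group G & PointedTopological G & isTopologicalGroup G}.

Definition borelType (T : ptopologicalType) : measurableType (@open T).-sigma :=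
  g_sigma_algebraType (@open T).

Section socle.
Context (K : pzRingType) (V : lmodType K) (mul : V -> V -> V).
(* [A] is a subset of [V] that is an algebra for [mul]; no unit is required. *)
Implicit Types A J : set V.

Definition left_ideal A J :=
  [/\ J `<=` A, J 0,
      forall (c : K) x y, J x -> J y -> J (c *: x + y) &
      forall a x, A a -> J x -> J (mul a x)].

Definition minimal_left_ideal A J :=
  [/\ left_ideal A J, J <> [set 0] &
      forall I, left_ideal A I -> I `<=` J -> I = [set 0] \/ I = J].

(* This is [set 0] when there is no minimal left ideal, since [set 0] is then
   the smallest left ideal. *)
Definition left_socle A :=
  smallest (left_ideal A) (\bigcup_(J in minimal_left_ideal A) J).

End socle.

Section complex_set_functions.
Context (R : realType) d (T : measurableType d).

Definition complex_set_fun : Type := set T -> R[i]^o.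

(* Values outside the sigma-algebra are forced to be 0, so that equality of
   complex measures is equality of functions. *)
Definition complex_measure (mu : complex_set_fun) :=
  [/\ semi_sigma_additive (fun A => (complex.Re (mu A))%:E),
      semi_sigma_additive (fun A => (complex.Im (mu A))%:E) &
      forall A, ~ measurable A -> mu A = 0].

Definition complex_variation (mu : complex_set_fun) (A : set T) : \bar R :=
  ereal_sup [set (\sum_(0 <= i <oo) (Normc.normc (mu (F i)))%:E)%E | F in
    [set F : (set T)^nat | [/\ forall i, measurable (F i), trivIset setT F &
                               \bigcup_i F i = A]]].

(* For a real-valued measure [r], [positive_variation r] and
   [positive_variation (- r)] form its Jordan decomposition. *)
Definition positive_variation (r : set T -> R) (A : set T) : \bar R :=
  ereal_sup [set (r B)%:E | B in [set B | measurable B /\ B `<=` A]].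

Definition signed_integral (r : set T -> R) (f : T -> R) : R :=
  fine (\int[positive_variation r]_x (f x)%:E) -
  fine (\int[positive_variation (fun A => (- r A)%R)]_x (f x)%:E).

Definition complex_integral (mu : complex_set_fun) (f : T -> R[i]) : R[i] :=
  let u A := complex.Re (mu A) in let v A := complex.Im (mu A) in
  let g x := complex.Re (f x) in let h x := complex.Im (f x) in
  Complex (signed_integral u g - signed_integral v h)
          (signed_integral u h + signed_integral v g).

Definition density_measure (lam : {measure set T -> \bar R}) (f : T -> R[i]) :
    complex_set_fun :=
  patch (fun=> 0) measurable (fun A =>
    Complex (\int[lam]_(x in A) complex.Re (f x))
            (\int[lam]_(x in A) complex.Im (f x))).

Definition complex_integrable (lam : {measure set T -> \bar R})
    (f : T -> R[i]) :=
  lam.-integrable setT (fun x => (complex.Re (f x))%:E) /\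
  lam.-integrable setT (fun x => (complex.Im (f x))%:E).

End complex_set_functions.

(* For finite [m] this is regularity by compact sets from inside and open sets
   from outside. *)
Definition radon (R : realType) (T : ptopologicalType)
    (m : set (borelType T) -> \bar R) :=
  [/\ forall K : set T, compact K -> (m K < +oo)%E,
      forall A : set (borelType T), measurable A ->
        m A = ereal_inf [set m U | U in [set U : set T | open U /\ A `<=` U]] &
      forall U : set T, open U ->
        m U = ereal_sup [set m K | K in [set K : set T | compact K /\ K `<=` U]]].

Section group_algebras.
Context (R : realType) (G : topologicalGroupType).
Local Notation T := (borelType G).

Definition left_haar (lam : {measure set T -> \bar R}) :=
  [/\ radon lam, lam setT <> 0%E &
      forall (x : G) (A : set T), measurable A ->
        lam [set (x * y)%g | y in (A : set G)] = lam A].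

(* The inner function of y is Borel when mu is regular, even if the Borel
   sigma-algebra of G * G is not the product one; no product measure is used. *)
Definition convolution (mu nu : complex_set_fun R T) : complex_set_fun R T :=
  patch (fun=> 0) (@measurable _ T) (fun A : set G =>
    complex_integral nu (fun y : G =>
      complex_integral mu (fun x : G => \1_A (x * y)%g))).

Definition measure_algebra : set (complex_set_fun R T) :=
  [set mu | complex_measure mu /\ radon (complex_variation mu)].

Definition group_algebra (lam : {measure set T -> \bar R}) :
    set (complex_set_fun R T) :=
  [set density_measure lam f | f in complex_integrable lam].

End group_algebras.

Arguments measure_algebra : clear implicits.

(* Main.v *)
Require Import Defs.
From HB Require Import structures.
From mathcomp Require Import all_boot all_order all_algebra.
From mathcomp Require Import cyclic separable cyclotomic.
From mathcomp Require Import complex ring lra zify.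
From mathcomp Require Import all_classical all_reals all_analysis.
From mathcomp Require Import measurable_realfun.
From mathcomp Require finmap.

(** Let [nu] be a nonzero finite regular measure each of whose left translates is
    a unimodular multiple of [nu].  Then [G] is compact: some compact [K] has
    [nu K <> 0], a noncompact group contains infinitely many disjoint translates
    of [K], and their masses all have the same nonzero modulus, against
    sigma-additivity ([compact_of_eigenmeasure]).  So in each of the three cases
    the task is to find such a [nu] in a minimal left ideal.

    Total mass is multiplicative for convolution.  If it is nonzero somewhere on
    the socle, it is nonzero at some [nu] in a minimal left ideal [J]; the
    elements of [J] of mass 0 form a smaller left ideal, so there are none but 0,
    and [a * nu - a(G) nu] is one of them.  Thus [a * nu = a(G) nu] for all [a]
    in the algebra ([socle_mass]).  In [M(G)] take for [a] the unit mass at [x]: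
    the translate [x nu] equals [nu].  In [L1(G)] compare the elements [nu] and
    [x nu], which have the same mass: [nu(G) (x nu) = x (nu * nu) = (x nu) * nu =
    nu(G) nu].

    In the abelian case let [J] be any minimal ideal of [L1(G)].  Since [L1(G)]
    does not annihilate [J] ([group_algebra_nondegenerate]), [J] is stable under
    translation by [x], and this translation [T] is an isometric endomorphism of
    the module [J].  By Schur's lemma and an argument of Gelfand-Mazur type it is
    a scalar ([isometric_endo_scalar]), necessarily of modulus 1.

    All these arguments rest on translates of measures and on the linearity and
    boundedness of [nu |-> a * nu].  They therefore apply to the integrand
    [y |-> a (A y^-1)] in the definition of [a * nu] as to an arbitrary bounded
    function.  The integral of a nonnegative function is the supremum over the
    simple functions below it, and for a bounded function this lower integral is
    additive with respect to finite measures ([lower_integral_add]); so the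
    integrals of bounded functions are linear with respect to signed measures. *)

Set Implicit Arguments.
Unset Strict Implicit.
Unset Printing Implicit Defensive.

Import Order.TTheory GRing.Theory Num.Theory.
Import numFieldNormedType.Exports.
Import Normc.

Local Open Scope classical_set_scope.
Local Open Scope ring_scope.

(** * Complex moduli and roots of unity *)

Section complex_modulus.
Context (R : rcfType).
Implicit Types z : R[i].

Lemma normc_ge0 z : 0 <= normc z.
Proof. by case: z => a b; exact: sqrtr_ge0. Qed.

Lemma Re_le_normc z : `|complex.Re z| <= normc z.
Proof. by case: z => a b /=; rewrite -sqrtr_sqr ler_psqrt ?nnegrE ?addr_ge0 ?sqr_ge0 // lerDl sqr_ge0. Qed.

Lemma Im_le_normc z : `|complex.Im z| <= normc z.
Proof. by case: z => a b /=; rewrite -sqrtr_sqr ler_psqrt ?nnegrE ?addr_ge0 ?sqr_ge0 // lerDr sqr_ge0. Qed.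

Lemma normc_le_ReIm z : normc z <= `|complex.Re z| + `|complex.Im z|.
Proof.
case: z => a b /=; rewrite -[leRHS]ger0_norm ?addr_ge0 // -[leRHS]sqrtr_sqr.
by rewrite ler_psqrt ?nnegrE ?addr_ge0 ?sqr_ge0 // sqrrD !real_normK ?num_real // lerD2r lerDl mulrn_wge0 // mulr_ge0.
Qed.
End complex_modulus.

Lemma closed_prim_root_exists (C : numClosedFieldType) n : (0 < n)%N ->
  exists z : C, n.-primitive_root z.
Proof.
move=> n0; have [r Dp] := closed_field_poly_normal ('X^n - 1 : {poly C}).
rewrite (monicP _) ?monicXnsubC // scale1r in Dp.
have rn : all n.-unity_root r by apply/allP => z; rewrite -root_prod_XsubC -Dp.
have ur : uniq r by rewrite -separable_prod_XsubC -Dp separable_Xn_sub_1 // pnatr_eq0 -lt0n.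
have sr : (n <= size r)%N by rewrite -ltnS -(size_prod_XsubC r id) -Dp size_XnsubC.
by have /hasP[z _ pz] := has_prim_root n0 rn ur sr; exists z.
Qed.

Lemma sum_prim_root (C : numClosedFieldType) n (z : C) k : n.-primitive_root z ->
  \sum_(i < n) (z ^+ i) ^+ k = if (n %| k)%N then n%:R else 0.
Proof.
move=> pz; under eq_bigr do rewrite exprAC.
rewrite (prim_order_dvd pz); case: eqP => [->|/eqP zk].
  by under eq_bigr do rewrite expr1n; rewrite sumr_const card_ord.
apply: (mulfI (_ : z ^+ k - 1 != 0)); first by rewrite subr_eq0.
by rewrite -subrX1 mulr0 exprAC (prim_expr_order pz) expr1n subrr.
Qed.

(** * Left ideals and the left socle *)

Section linear_subspaces.
Context (K : pzRingType) (V : lmodType K).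
Implicit Types J : set V.

Definition linear_subspace J :=
  J 0 /\ forall (c : K) x y, J x -> J y -> J (c *: x + y).

Definition linear_on (L : lmodType K) J (w : V -> L) :=
  forall (c : K) x y, J x -> J y -> w (c *: x + y) = c *: w x + w y.

Section subspace.
Variable J : set V.
Hypothesis sJ : linear_subspace J.

Lemma subspaceZ c x : J x -> J (c *: x).
Proof. by move=> Jx; rewrite -[_ *: _]addr0; apply: sJ.2 => //; exact: sJ.1. Qed.

Lemma subspaceD x y : J x -> J y -> J (x + y).
Proof. by move=> Jx Jy; rewrite -[x]scale1r; apply: sJ.2. Qed.

Lemma subspaceB x y : J x -> J y -> J (x - y).
Proof.
by move=> Jx Jy; apply: subspaceD => //; rewrite -scaleN1r; apply: subspaceZ.
Qed.

Lemma subspace_sum n (F : 'I_n -> V) : (forall i, J (F i)) -> J (\sum_i F i).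
Proof.
by move=> JF; elim/big_ind: _ => // [|x y Jx Jy]; [exact: sJ.1|exact: subspaceD].
Qed.

Lemma subspace_neq0 : J <> [set 0] -> exists2 x, J x & x <> 0.
Proof.
move=> JN0; apply: contrapT => none; apply: JN0; apply/seteqP; split => [x Jx|_ ->].
  by apply: contrapT => xn0; apply: none; exists x.
exact: sJ.1.
Qed.

Variables (L : lmodType K) (w : V -> L).
Hypothesis wl : linear_on J w.

Lemma linear_on0 : w 0 = 0.
Proof.
by have := wl (-1) sJ.1 sJ.1; rewrite scaler0 add0r scaleN1r addNr.
Qed.

Lemma linear_onZ c x : J x -> w (c *: x) = c *: w x.
Proof.
move=> Jx; rewrite -[c *: x]addr0 wl ?linear_on0 ?addr0 //; exact: sJ.1.
Qed.

Lemma linear_onB x y : J x -> J y -> w (x - y) = w x - w y.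
Proof. by move=> Jx Jy; rewrite addrC -scaleN1r wl // scaleN1r addrC. Qed.

Lemma linear_on_sum n (F : 'I_n -> V) : (forall i, J (F i)) ->
  w (\sum_i F i) = \sum_i w (F i).
Proof.
elim: n F => [|n IH] F JF; first by rewrite !big_ord0 linear_on0.
rewrite !big_ord_recl -[F ord0 in LHS]scale1r wl //; first by rewrite scale1r IH.
by apply: subspace_sum.
Qed.
End subspace.
End linear_subspaces.

Section socle.
Context (K : pzRingType) (V : lmodType K) (mul : V -> V -> V) (A : set V).
Implicit Types J : set V.

Lemma left_ideal_subspace J : left_ideal mul A J -> linear_subspace J.
Proof. by case. Qed.

Hypothesis sA : linear_subspace A.
Hypothesis mul_linear : forall a, A a -> linear_on A (mul a).

Lemma zero_left_ideal : left_ideal mul A [set 0].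
Proof.
split=> //; first by move=> _ ->; exact: sA.1.
  by move=> c _ _ -> ->; rewrite scaler0 addr0.
by move=> a _ Aa ->; rewrite /= (linear_on0 sA (mul_linear Aa)).
Qed.

Lemma left_socle_neq0 : left_socle mul A <> [set 0] ->
  exists J, minimal_left_ideal mul A J.
Proof.
move=> soc0; apply: contrapT => noJ; apply: soc0; apply/seteqP; split=> [x Sx|_ ->].
  by apply: Sx; split; [exact: zero_left_ideal | move=> y [J mJ]; case: noJ; exists J].
by move=> I [] [].
Qed.

(** The finite sums of elements of minimal left ideals form a left ideal, because
    the product is additive and preserves each of these ideals.  So a linear map
    that vanishes on all minimal left ideals vanishes on the socle. *)
Lemma minimal_left_ideal_of_socle (L : lmodType K) (t : V -> L) mu :
  linear_on setT t -> left_socle mul A mu -> t mu <> 0 ->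
  exists J nu, [/\ minimal_left_ideal mul A J, J nu & t nu <> 0].
Proof.
move=> tlin Smu tmu; apply: contrapT => none.
have t0 J : minimal_left_ideal mul A J -> forall x, J x -> t x = 0.
  by move=> mJ x Jx; apply: contrapT => tx; apply: none; exists J, x.
have sT : linear_subspace [set: V] by split.
have tz := linear_on0 sT tlin.
pose good (s : seq V) := forall y, y \in s ->
  exists2 J, minimal_left_ideal mul A J & J y.
pose S : set V := [set x | exists2 s, good s & x = \sum_(y <- s) y].
have good_cons y s : good (y :: s) ->
    (exists2 J, minimal_left_ideal mul A J & J y) /\ good s.
  move=> gs; split; first by apply: gs; exact: mem_head.
  by move=> z zs; apply: gs; rewrite inE zs orbT.
have good_map f s : good s ->
    (forall J x, minimal_left_ideal mul A J -> J x -> J (f x)) -> good (map f s).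
  move=> gs fJ _ /mapP[y /gs[J mJ Jy] ->]; exists J => //; exact: fJ Jy.
have goodA s : good s -> A (\sum_(y <- s) y).
  elim: s => [|y s IH] gs; first by rewrite big_nil; exact: sA.1.
  have [[J [[JA _ _ _] _ _] Jy] gs'] := good_cons _ _ gs.
  by rewrite big_cons; apply: subspaceD => //; [exact: JA | exact: IH].
have Sideal : left_ideal mul A S.
  split.
  - by move=> _ [s gs ->]; exact: goodA.
  - by exists [::] => //; rewrite big_nil.
  - move=> c _ _ [s gs ->] [s' gs' ->].
    exists (map ( *:%R c) s ++ s'); last first.
      by rewrite big_cat big_map scaler_sumr.
    move=> y; rewrite mem_cat => /orP[|/gs'//]; apply: good_map => // J x [].
    by move=> /left_ideal_subspace sJ _ _; exact: subspaceZ.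
  - move=> a _ Aa [s gs ->]; exists (map (mul a) s).
      by apply: good_map => // J x [[_ _ _ JM] _ _] Jx; exact: JM.
    elim: s gs => [|y s IH] gs.
      by rewrite !big_nil (linear_on0 sA (mul_linear Aa)).
    have [[J [[JA _ _ _] _ _] Jy] gs'] := good_cons _ _ gs.
    rewrite /= !big_cons -[y in LHS]scale1r mul_linear ?scale1r ?IH //.
      exact: JA.
    exact: goodA.
have [s gs mus] : S mu.
  apply: Smu; split => // x [J mJ Jx]; exists [:: x]; last by rewrite big_seq1.
  by move=> y; rewrite inE => /eqP ->; exists J.
apply: tmu; rewrite mus {mus}; elim: s gs => [|y s IH] gs; first by rewrite big_nil.
have [[J mJ Jy] gs'] := good_cons _ _ gs.
by rewrite big_cons -[y]scale1r tlin // scale1r IH // (t0 J mJ y Jy) addr0.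
Qed.

(** Inside a minimal left ideal the kernel of a multiplicative functional that
    does not vanish there is a proper subideal, hence trivial; and
    [mul a nu - t a *: nu] lies in that kernel. *)
Lemma minimal_left_ideal_augmentation (t : V -> K^o) J nu : linear_on setT t ->
  (forall a x, A a -> A x -> t (mul a x) = t a * t x) ->
  minimal_left_ideal mul A J -> J nu -> t nu <> 0 ->
  forall a, A a -> mul a nu = (t a : K) *: nu.
Proof.
move=> tlin tmul [iJ _ minJ] Jnu tnu a Aa.
have sJ := left_ideal_subspace iJ; have [JA _ _ JM] := iJ.
have sT : linear_subspace [set: V] by split.
pose I : set V := [set x | J x /\ t x = 0].
have iI : left_ideal mul A I.
  split.
  - by move=> x [/JA].
  - by split; [exact: sJ.1|exact: (linear_on0 sT tlin)].
  - move=> c x y [Jx tx] [Jy ty]; split; first exact: sJ.2.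
    by rewrite tlin // tx ty scaler0 addr0.
  - move=> b x Ab [Jx tx]; split; first exact: JM.
    by rewrite tmul ?tx ?mulr0 //; exact: JA.
have [I0|IJ] := minJ _ iI (fun x => @proj1 _ _).
  have : I (mul a nu - (t a : K) *: nu).
    split; first by apply: subspaceB => //; [exact: JM|exact: subspaceZ].
    rewrite (linear_onB tlin) // tmul //; last exact: JA.
    by rewrite (linear_onZ sT tlin) // [X in _ - X]/(t a * t nu) subrr.
  by rewrite I0 => /eqP; rewrite subr_eq0 => /eqP.
by case: tnu; move: Jnu; rewrite -IJ => -[].
Qed.
End socle.

(** * Endomorphisms of a minimal left ideal *)

Section endomorphisms.
Context (R : realType) (V : lmodType R[i]) (mul : V -> V -> V) (A J : set V).
Context (N : V -> R) (T : V -> V).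

Definition module_endo (w : V -> V) :=
  [/\ linear_on J w, forall x, J x -> J (w x) &
      forall a x, A a -> J x -> w (mul a x) = mul a (w x)].

Hypothesis mJ : minimal_left_ideal mul A J.
Hypothesis mul_linear : forall a, A a -> linear_on A (mul a).
Hypothesis ND : forall x y, J x -> J y -> N (x + y) <= N x + N y.
Hypothesis NZ : forall c x, J x -> N (c *: x) = normc c * N x.
Hypothesis N_eq0 : forall x, J x -> N x = 0 -> x = 0.
Hypothesis Nmul : forall a, A a -> exists C, forall x, J x -> N (mul a x) <= C * N x.
Hypothesis eT : module_endo T.
Hypothesis NT : forall x, J x -> N (T x) = N x.

Let iJ : left_ideal mul A J. Proof. by case: mJ. Qed.
Let sJ : linear_subspace J. Proof. exact: left_ideal_subspace iJ. Qed.
Let JA x : J x -> A x. Proof. by case: iJ => + _ _ _; apply. Qed.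
Let JM a x : A a -> J x -> J (mul a x). Proof. by case: iJ => _ _ _; apply. Qed.
Let JZ c x : J x -> J (c *: x). Proof. exact: subspaceZ. Qed.
Let TJ x : J x -> J (T x). Proof. by case: eT => _ + _; apply. Qed.

Let mulJ a : A a -> linear_on J (mul a).
Proof. by move=> Aa c x y Jx Jy; apply: mul_linear => //; exact: JA. Qed.

Lemma comp_endo w w' : module_endo w -> module_endo w' -> module_endo (w \o w').
Proof.
move=> [wl wJ wM] [wl' wJ' wM']; split => [c x y Jx Jy|x Jx|a x Aa Jx] /=.
- by rewrite wl' // wl //; exact: wJ'.
- exact/wJ/wJ'.
- by rewrite wM' // wM //; exact: wJ'.
Qed.

(** Schur's lemma: the image of an endomorphism is a left ideal. *)
Lemma minimal_left_ideal_schur w : module_endo w ->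
  (exists2 x, J x & w x <> 0) -> forall y, J y -> exists2 x, J x & w x = y.
Proof.
move=> ew [x0 Jx0 wx0]; have [wl wJ wM] := ew.
have imI : left_ideal mul A (w @` J).
  split.
  - by move=> _ [x Jx <-]; apply/JA/wJ.
  - by exists 0; [exact: sJ.1|exact: (linear_on0 sJ wl)].
  - move=> c _ _ [x Jx <-] [y Jy <-]; exists (c *: x + y); first exact: sJ.2.
    exact: wl.
  - by move=> a _ Aa [x Jx <-]; exists (mul a x); [exact: JM|exact: wM].
have [_ _ minJ] := mJ.
have wsub : w @` J `<=` J by move=> _ [x Jx <-]; exact: wJ.
have [w0|wE] := minJ _ imI wsub.
  by case: wx0; have : (w @` J) (w x0); [exists x0 | rewrite w0].
by move=> y; rewrite -{1}wE.
Qed.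

Let normJ0 : N 0 = 0.
Proof. by rewrite -(scale0r 0) NZ ?normc0 ?mul0r //; exact: sJ.1. Qed.

Let normJ_ge0 x : J x -> 0 <= N x.
Proof.
move=> Jx; have : N (x + (-1) *: x) <= N x + N ((-1) *: x) by apply: ND => //; exact: JZ.
rewrite NZ // normcN normc1 scaleN1r subrr normJ0; lra.
Qed.

Let normJ_sum n (F : 'I_n -> V) b : (forall i, J (F i)) -> (forall i, N (F i) <= b) ->
  N (\sum_i F i) <= n%:R * b.
Proof.
move=> JF NF; elim: n F JF NF => [|n IH] F JF NF; first by rewrite big_ord0 normJ0 mul0r.
rewrite big_ord_recl (le_trans (ND _ _)) //; first by apply: (subspace_sum sJ).
by rewrite -natr1 mulrDl mul1r addrC lerD // IH.
Qed.

(** The elements [x] such that [N (w x)] is controlled by [N (w j0)] for all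
    endomorphisms [w] form a left ideal, hence are all of [J].  For [d k = j0]
    this turns the surjectivity of [d] into a bound from below; it replaces the
    continuity of inverses in a Banach algebra. *)
Lemma onto_bounded_below j0 d : J j0 -> j0 <> 0 -> module_endo d ->
  (exists2 x, J x & d x = j0) ->
  exists C, forall w, module_endo w -> N (w j0) <= C * N (w (d j0)).
Proof.
move=> Jj0 j0n0 ed [k Jk dk].
pose I : set V := [set x | J x /\
  exists C, forall w, module_endo w -> N (w x) <= C * N (w j0)].
have iI : left_ideal mul A I.
  split.
  - by move=> x [/JA].
  - split; first exact: sJ.1.
    by exists 0 => w [wl _ _]; rewrite mul0r (linear_on0 sJ wl) normJ0.
  - move=> c x y [Jx [C HC]] [Jy [C' HC']]; split; first exact: sJ.2.
    exists (normc c * C + C') => w ew; have [wl wJ wM] := ew.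
    rewrite wl // (le_trans (ND _ _)) //; [exact/JZ/wJ|exact: wJ|].
    rewrite mulrDl NZ; last exact: wJ.
    apply: lerD; last exact: HC'.
    rewrite -mulrA ler_wpM2l ?HC //; exact: normc_ge0.
  - move=> a x Aa [Jx [C HC]]; split; first exact: JM.
    have [Ca HCa] := Nmul Aa.
    exists (`|Ca| * C) => w ew; have [wl wJ wM] := ew.
    rewrite wM // (le_trans (HCa _ _)) //; first exact: wJ.
    apply: le_trans (_ : `|Ca| * N (w x) <= _).
      by rewrite ler_wpM2r ?normJ_ge0 ?ler_norm //; exact: wJ.
    by rewrite -mulrA ler_wpM2l ?HC.
have Ij0 : I j0 by split=> //; exists 1 => w _; rewrite mul1r.
have [_ _ minJ] := mJ; have [I0|IJ] := minJ _ iI (fun x => @proj1 _ _).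
  by case: j0n0; move: Ij0; rewrite I0.
have [_ [C HC]] : I k by rewrite IJ.
exists C => w ew; rewrite -[in w j0]dk.
exact: (HC (w \o d) (comp_endo ew ed)).
Qed.

Let D z x := z *: T x - x.

Let D_endo z : module_endo (D z).
Proof.
have [Tl _ TM] := eT; split => [c x y Jx Jy|x Jx|a x Aa Jx].
- rewrite /D Tl // scalerDr opprD !scalerA [z * c]mulrC scalerBr scalerA.
  by rewrite -!addrA; congr (_ + _); rewrite addrCA.
- by apply: subspaceB => //; apply/JZ/TJ.
- have JTx := TJ Jx; rewrite /D (linear_onB (mulJ Aa)) //; last exact: JZ.
  by rewrite (linear_onZ sJ (mulJ Aa)) // TM.
Qed.

Let JD z x : J x -> J (D z x). Proof. by case: (D_endo z) => _ + _; apply. Qed.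

Let commT w := forall x, J x -> w (T x) = T (w x).

(** A lower bound at [z] persists, with twice the constant, near [z]; then
    compactness of the square makes it uniform. *)
Lemma bounded_below_uniform j0 : J j0 ->
  (forall z, exists C, forall w, module_endo w -> N (w j0) <= C * N (w (D z j0))) ->
  exists2 C, 0 <= C & forall z, `|complex.Re z| <= 1 -> `|complex.Im z| <= 1 ->
    forall w, module_endo w -> commT w -> N (w j0) <= C * N (w (D z j0)).
Proof.
move=> Jj0 bnd.
pose Q := (`[-1, 1] `*` `[-1, 1])%classic : set (R^o * R^o)%type.
have cQ : compact Q by apply: compact_setX; exact: segment_compact.
pose P (C : R) (p : (R^o * R^o)%type) := forall w, module_endo w -> commT w ->
  N (w j0) <= C * N (w (D (Complex p.1 p.2) j0)).
have : \forall C \near +oo, Q `<=` P C.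
  have := (compact_near_coveringP _).1 cQ R (pinfty_nbhs R) P.
  apply=> // p _; have [C0 HC0] := bnd (Complex p.1 p.2).
  (* A perturbation of [z] by at most [2 e] costs at most [C1 * 2 e = 1/2] of
     [N (w j0)], which is absorbed by the left-hand side. *)
  pose C1 := Num.max 1 C0; have C1ge1 : 1 <= C1 by rewrite le_max lexx.
  have C1gt0 : 0 < C1 by lra.
  pose e := (4 * C1)^-1; have e0 : 0 < e by rewrite invr_gt0 mulr_gt0.
  exists ((ball p.1 e `*` ball p.2 e)%classic, [set C | 2 * C1 < C]) => /=.
    split; last by exists (2 * C1); split => //; rewrite num_real.
    exists (ball p.1 e, ball p.2 e) => //.
    by split => /=; exact: nbhsx_ballx.
  case=> [q C] /= [[q1 q2] CC1] w ew wT; have [wl wJ _] := ew.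
  set z := Complex p.1 p.2; set z' := Complex q.1 q.2.
  have Dzz' : D z j0 = (z - z') *: T j0 + D z' j0.
    by rewrite /D scalerBl addrA subrK.
  have small : normc (z - z') <= 2 * e.
    apply: (le_trans (normc_le_ReIm _)) => /=.
    by move: q1 q2; rewrite /ball /= => q1 q2; lra.
  have step : N (w (D z j0)) <= 2 * e * N (w j0) + N (w (D z' j0)).
    have JwT : J (w (T j0)) by exact/wJ/TJ.
    rewrite Dzz' wl; [|exact: TJ|exact: JD].
    apply: (le_trans (ND (JZ _ JwT) (wJ _ (JD _ Jj0)))).
    rewrite lerD2r NZ // wT // NT; last exact: wJ.
    by apply: ler_wpM2r => //; exact/normJ_ge0/wJ.
  have N1 : N (w j0) <= C1 * N (w (D z j0)).
    apply: (le_trans (HC0 w ew)); apply: ler_wpM2r; first exact/normJ_ge0/wJ/JD.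
    by rewrite le_max lexx orbT.
  have eC : C1 * (2 * e) = 1 / 2 by rewrite /e; field; rewrite gt_eqF.
  have N2 : C1 * N (w (D z j0)) <= 1 / 2 * N (w j0) + C1 * N (w (D z' j0)).
    by rewrite -eC -mulrA -mulrDr ler_pM2l.
  have : (C1 + C1) * N (w (D z' j0)) <= C * N (w (D z' j0)).
    by apply: ler_wpM2r; [exact/normJ_ge0/wJ/JD|lra].
  lra.
case=> C [_ HC]; pose C' := Num.max 0 C + 1.
exists C'; first by rewrite addr_ge0 ?le_max ?lexx.
move=> z rez imz; have : Q (complex.Re z, complex.Im z).
  by split; rewrite /= in_itv /= -ler_norml.
move/(HC C') => + w ew wT; rewrite /P /=.
have CC' : C < C' by rewrite /C' ltr_pwDr // le_max lexx orbT.
by move=> /(_ CC' w ew wT); case: z {rez imz}.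
Qed.

Let endo_iter k : module_endo (iter k T).
Proof. by elim: k => [|k IH]; [split | exact: comp_endo eT IH]. Qed.

Let J_iter k x : J x -> J (iter k T x).
Proof. by case: (endo_iter k) => _ + _; apply. Qed.

Let norm_iter k x : J x -> N (iter k T x) = N x.
Proof. by move=> Jx; elim: k => //= k IH; rewrite NT //; exact: J_iter. Qed.

Let S n z x := \sum_(k < n) z ^+ k *: iter k T x.

Let S_endo n z : module_endo (S n z).
Proof.
split=> [c x y Jx Jy|x Jx|a x Aa Jx].
- rewrite /S scaler_sumr -big_split; apply: eq_bigr => k _ /=.
  case: (endo_iter k) => -> // _ _; rewrite scalerDr !scalerA; congr (_ *: _ + _).
  exact: mulrC.
- by apply: (subspace_sum sJ) => k; exact/JZ/J_iter.
- rewrite /S (linear_on_sum sJ (mulJ Aa)) => [|k]; last exact/JZ/J_iter.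
  apply: eq_bigr => k _; rewrite (linear_onZ sJ (mulJ Aa)); last exact: J_iter.
  by case: (endo_iter k) => _ _ ->.
Qed.

Let JS n z x : J x -> J (S n z x). Proof. by case: (S_endo n z) => _ + _; apply. Qed.

Let S_comm n z : commT (S n z).
Proof.
have [Tl _ _] := eT.
move=> x Jx; rewrite /S (linear_on_sum sJ Tl) => [|k]; last exact/JZ/J_iter.
by apply: eq_bigr => k _; rewrite -iterSr (linear_onZ sJ Tl) //; exact: J_iter.
Qed.

Let S_telescope n z x : J x -> z ^+ n = 1 -> S n z (D z x) = iter n T x - x.
Proof.
move=> Jx zn.
transitivity (\sum_(0 <= k < n) (z ^+ k.+1 *: iter k.+1 T x - z ^+ k *: iter k T x)).
  rewrite big_mkord; apply: eq_bigr => k _; have [Tkl _ _] := endo_iter k.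
  have JTx := TJ Jx; rewrite /D (linear_onB Tkl) //; last exact: JZ.
  by rewrite (linear_onZ sJ Tkl) // -iterSr scalerBr scalerA -exprSr.
by rewrite (telescope_sumr (fun k => z ^+ k *: iter k T x)) //= expr0 scale1r zn scale1r.
Qed.

Let S_sq n z x : J x ->
  S n z (S n z x) = \sum_(k < n) \sum_(l < n) z ^+ (k + l) *: iter (k + l) T x.
Proof.
move=> Jx; rewrite {1}/S; apply: eq_bigr => k _; have [Tkl _ _] := endo_iter k.
rewrite /S (linear_on_sum sJ Tkl) => [|l]; last exact/JZ/J_iter.
rewrite scaler_sumr; apply: eq_bigr => l _.
by rewrite (linear_onZ sJ Tkl) ?scalerA -?exprD ?iterD //; exact: J_iter.
Qed.

(** Averaging [z S S] over the [n]-th roots of unity selects the pairs of powers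
    with [k + l + 1 = n], of which there are [n]. *)
Let S_average n zeta x : J x -> n.-primitive_root zeta ->
  \sum_(i < n) zeta ^+ i *: S n (zeta ^+ i) (S n (zeta ^+ i) x) =
  (n%:R * n%:R) *: iter n.-1 T x.
Proof.
move=> Jx pz; have n0 := prim_order_gt0 pz.
under eq_bigr => i _.
  rewrite S_sq // scaler_sumr; under eq_bigr => k _.
    rewrite scaler_sumr; under eq_bigr do rewrite scalerA -exprS.
    over.
  over.
rewrite exchange_big /=.
transitivity (\sum_(k < n) n%:R *: iter n.-1 T x); last first.
  by rewrite sumr_const card_ord -scaler_nat scalerA.
apply: eq_bigr => k _; rewrite exchange_big /=.
under eq_bigr do rewrite -scaler_suml (sum_prim_root _ pz).
rewrite (bigD1 (rev_ord k)) //= big1 => [|l lk].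
  have -> : (k + (n - k.+1))%N = n.-1 by have := ltn_ord k; lia.
  by rewrite prednK // dvdnn addr0.
rewrite ifF ?scale0r //; apply/negbTE; apply: contra lk => /dvdnP[q].
have := ltn_ord k; have := ltn_ord l => ln kn kl.
have q1 : q = 1%N.
  case: q kl => [|[|q]] //; rewrite ?mul0n // => e.
  by exfalso; rewrite !mulSn in e; lia.
by apply/eqP/val_inj => /=; rewrite q1 mul1n in kl; lia.
Qed.

Let normc_root n z : (0 < n)%N -> z ^+ n = 1 -> normc (z : R[i]) = 1.
Proof.
move=> n0 zn; apply/eqP; rewrite -(@pexpr_eq1 _ _ n) ?normc_ge0 //.
have normcX m : normc (z ^+ m) = normc z ^+ m.
  by elim: m => [|m IH]; rewrite ?normc1 // !exprS normcM IH.
by rewrite -normcX zn normc1.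
Qed.

(** Each factor [S] costs one use of the lower bound for [z T - 1], since
    [S (z T - 1) = T^n - 1] has norm at most 2. *)
Let S_bound n z C j0 : (0 < n)%N -> z ^+ n = 1 -> J j0 -> 0 <= C ->
  (forall w, module_endo w -> commT w -> N (w j0) <= C * N (w (D z j0))) ->
  N (S n z (S n z j0)) <= 4 * C ^+ 2 * N j0.
Proof.
move=> n0 zn Jj0 C0 HC.
have N2 x : J x -> N (iter n T x - x) <= 2 * N x.
  move=> Jx; rewrite -scaleN1r (le_trans (ND _ _)) //; [exact: J_iter|exact: JZ|].
  by rewrite NZ // normcN normc1 mul1r norm_iter // mulr_natl.
have b1 : N (S n z j0) <= C * (2 * N j0).
  apply: (le_trans (HC _ (S_endo n z) (@S_comm n z))).
  by rewrite S_telescope // ler_wpM2l // N2.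
have cSS : commT (S n z \o S n z) by move=> x Jx /=; rewrite !S_comm //; exact: JS.
apply: (le_trans (HC _ (comp_endo (S_endo n z) (S_endo n z)) cSS)) => /=.
have -> : S n z (S n z (D z j0)) = iter n T (S n z j0) - S n z j0.
  rewrite -(@S_telescope n z) //; last exact: JS.
  have [Sl _ _] := S_endo n z; have JTj0 := TJ Jj0.
  rewrite {2}/D (linear_onB Sl) //; last exact: JZ.
  by rewrite (linear_onZ sJ Sl) // S_comm.
apply: (@le_trans _ _ (C * (2 * (C * (2 * N j0))))); last by rewrite expr2; lra.
rewrite ler_wpM2l //; apply: (le_trans (N2 _ (JS _ _ Jj0))).
by rewrite ler_wpM2l.
Qed.

(** A form of the Gelfand-Mazur theorem.  If no [z T - 1] vanished on [J], all
    of them would be onto by Schur's lemma, hence bounded below, uniformly on the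
    unit circle.  For [z ^ n = 1] and [S = 1 + z T + ... + (z T)^(n-1)] the norm
    of [S S j0] would then be bounded independently of [n], whereas the mean of
    [z S S j0] over the [n]-th roots of unity is [n T^(n-1) j0]. *)
Lemma isometric_endo_scalar :
  exists2 c, normc c = 1 & forall x, J x -> T x = c *: x.
Proof.
have [_ JN0 _] := mJ; have [j0 Jj0 j0n0] := subspace_neq0 sJ JN0.
have Nj0 : 0 < N j0.
  by rewrite lt_neqAle normJ_ge0 // andbT eq_sym; apply/eqP => /(N_eq0 Jj0).
have [[z Dz]|none] := pselect (exists z, forall x, J x -> D z x = 0).
  have Tz x : J x -> z *: T x = x by move=> /Dz /eqP; rewrite subr_eq0 => /eqP.
  have zn0 : z != 0.
    by apply/eqP => z0; apply: j0n0; rewrite -(Tz j0 Jj0) z0 scale0r.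
  have Tzi x : J x -> T x = z^-1 *: x.
    by move=> Jx; rewrite -{2}(Tz x Jx) scalerA mulVf // scale1r.
  exists z^-1 => //; apply: (mulIf (lt0r_neq0 Nj0)).
  by rewrite -NZ // -Tzi // NT // mul1r.
have bnd z : exists C, forall w, module_endo w -> N (w j0) <= C * N (w (D z j0)).
  apply: onto_bounded_below => //.
  apply: minimal_left_ideal_schur => //.
  apply: contrapT => Dz0; apply: none; exists z => x Jx.
  by apply: contrapT => Dzx; apply: Dz0; exists x.
have [C C0 HC] := bounded_below_uniform Jj0 bnd.
pose n := Num.bound (4 * C ^+ 2).
have nC : 4 * C ^+ 2 < n%:R by rewrite archi_boundP // mulr_ge0 // sqr_ge0.
clearbody n.
have n0 : (0 < n)%N by rewrite -(ltr_nat R) (le_lt_trans _ nC) // mulr_ge0 // sqr_ge0.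
have [zeta pz] := closed_prim_root_exists (R[i] : numClosedFieldType) n0.
have znth (i : 'I_n) : (zeta ^+ i) ^+ n = 1.
  by rewrite exprAC (prim_expr_order pz) expr1n.
have : N (\sum_(i < n) zeta ^+ i *: S n (zeta ^+ i) (S n (zeta ^+ i) j0))
    <= n%:R * (4 * C ^+ 2 * N j0).
  apply: normJ_sum => i; first exact/JZ/JS/JS.
  have z1 := normc_root n0 (znth i).
  rewrite NZ; last exact/JS/JS.
  rewrite z1 mul1r; apply: S_bound => // w ew wT; apply: HC => //.
    by rewrite -z1 Re_le_normc.
  by rewrite -z1 Im_le_normc.
rewrite S_average // NZ; last exact: J_iter.
have normcn : normc (n%:R * n%:R : R[i]) = n%:R * n%:R.
  rewrite normcM; suff -> : normc (n%:R : R[i]) = n%:R by [].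
  by have := normr_nat R[i] n => /(congr1 (@complex.Re R)) /=; rewrite -raddfMn.
rewrite normcn norm_iter // -mulrA ler_pM2l ?ltr0n // ler_pM2r //; lra.
Qed.
End endomorphisms.

(** * Signed measures and their Jordan decomposition *)

Section jordan.
Context d (T : measurableType d) (R : realType).
Implicit Types (r s : set T -> R) (A B : set T).

Definition signed_measure r := semi_sigma_additive (fun A => (r A)%:E).

(** The partial sums are real numbers, so the convergence in the extended reals
    is convergence in [R]. *)
Lemma signed_measureP r : signed_measure r <->
  forall F : (set T)^nat, (forall i, measurable (F i)) -> trivIset setT F ->
    series (r \o F) @ \oo --> r (\bigcup_n F n).
Proof.
have E (F : (set T)^nat) : (fun n => \sum_(0 <= i < n) (r (F i))%:E)%E
    = EFin \o series (r \o F).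
  by apply/funext => n; rewrite sumEFin.
split=> [sr F mF tF|sr F mF tF mUF].
  have := sr F mF tF (bigcup_measurable (fun k _ => mF k)).
  by rewrite E => /fine_cvg.
rewrite E; apply: cvg_EFin; last exact: sr.
by apply: nearW.
Qed.

Lemma signed_measure_lin r s c : signed_measure r -> signed_measure s ->
  signed_measure (fun A => c * r A + s A).
Proof.
move=> /signed_measureP sr /signed_measureP ss; apply/signed_measureP => F mF tF.
rewrite (_ : series _ = (fun n => c * series (r \o F) n + series (s \o F) n)).
  by apply: cvgD; [apply: cvgMr; exact: sr|exact: ss].
apply/funext => n; rewrite /series /= big_distrr -big_split /=.
by apply: eq_bigr.
Qed.

Lemma signed_measure_scale c r : signed_measure r -> signed_measure (fun A => c * r A).
Proof.
move=> /signed_measureP sr; apply/signed_measureP => F mF tF.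
rewrite (_ : series _ = (fun n => c * series (r \o F) n)).
  by apply: cvgMr; exact: sr.
by apply/funext => n; rewrite /series /= big_distrr.
Qed.

Lemma signed_measure_opp r : signed_measure r -> signed_measure (fun A => - r A).
Proof.
move=> /(@signed_measure_scale (-1)).
by congr signed_measure; apply/funext => A; rewrite mulN1r.
Qed.

Lemma signed_measure0 r : signed_measure r -> r set0 = 0.
Proof.
move=> /signed_measureP /(_ (fun=> set0) (fun=> measurable0) (@trivIset_set0 _ _ setT)).
rewrite bigcup0// => h; have /cvg_series_cvg_0 h0 : cvgn (series (r \o (fun=> set0))).
  by apply/cvg_ex; exists (r set0).
exact: (cvg_unique _ (cvg_cst _) h0).
Qed.

Lemma signed_measure_charge r : signed_measure r ->
  exists nu : {charge set T -> \bar R}, nu = (fun A => (r A)%:E) :> (set T -> \bar R).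
Proof.
move=> sr.
have r0 : (r set0)%:E = 0%E :> \bar R by rewrite signed_measure0.
pose m := isCharge.Build d T R (fun A => (r A)%:E) r0 (fun A _ => erefl) sr.
pose m' : {charge set T -> \bar R} := HB.pack (fun A => (r A)%:E) m.
by exists m'.
Qed.

Lemma signed_measureU r A B : signed_measure r -> measurable A -> measurable B ->
  A `&` B = set0 -> r (A `|` B) = r A + r B.
Proof.
move=> /signed_measure_charge[nu nuE] mA mB AB0.
by have := chargeU nu mA mB AB0; rewrite nuE => -[].
Qed.

Lemma positive_variation_hahn r : signed_measure r -> exists P N,
  [/\ measurable P, measurable N,
      forall A, measurable A -> positive_variation r A = (r (A `&` P))%:E,
      forall A, measurable A ->
        positive_variation (fun B => - r B) A = (- r (A `&` N))%:E &
      forall A, measurable A -> r A = r (A `&` P) + r (A `&` N)].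
Proof.
move=> sr; have [nu nuE] := signed_measure_charge sr.
have [P [N [[mP posP] [mN negN] PNT PN0]]] := Hahn_decomposition nu.
have rP A : measurable A -> A `<=` P -> 0 <= r A.
  by move=> mA AP; have := posP A mA AP; rewrite nuE lee_fin.
have rN A : measurable A -> A `<=` N -> r A <= 0.
  by move=> mA AN; have := negN A mA AN; rewrite nuE lee_fin.
have rE A : measurable A -> r A = r (A `&` P) + r (A `&` N).
  move=> mA; rewrite -[in LHS](setIT A) -PNT setIUr signed_measureU //;
    try exact: measurableI.
  by rewrite setIACA setIid PN0 setI0.
have mono A B Q : measurable A -> measurable B -> measurable Q -> B `<=` A ->
    r (A `&` Q) = r (B `&` Q) + r ((A `\` B) `&` Q).
  move=> mA mB mQ BA; rewrite -[in LHS](setDUK BA) setIUl signed_measureU //.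
  - exact: measurableI.
  - by apply: measurableI => //; exact: measurableD.
  - by rewrite setIACA setDIK set0I.
exists P, N; split=> // A mA; apply/eqP; rewrite eq_le; apply/andP; split.
- apply: ge_ereal_sup => _ [B [mB BA] <-]; rewrite lee_fin (rE B mB).
  rewrite (mono A B P) // lerD2l (@le_trans _ _ 0) //.
    by apply: rN; [exact: measurableI|exact: subIsetr].
  apply: rP; last exact: subIsetr.
  by apply: measurableI => //; exact: measurableD.
- apply: ereal_sup_ubound; exists (A `&` P) => //; split; last exact: subIsetl.
  exact: measurableI.
- apply: ge_ereal_sup => _ [B [mB BA] <-]; rewrite lee_fin (rE B mB) lerN2.
  rewrite (mono A B N) // addrC lerD2r (@le_trans _ _ 0) //.
    apply: rN; last exact: subIsetr.
    by apply: measurableI => //; exact: measurableD.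
  by apply: rP; [exact: measurableI|exact: subIsetr].
- apply: ereal_sup_ubound; exists (A `&` N) => //; split; last exact: subIsetl.
  exact: measurableI.
Qed.

(** [positive_variation] is a bare set function; only when [r] is sigma-additive
    is it a measure, and then the theory of integrals applies to it. *)
Lemma jordan_measure r : signed_measure r ->
  exists m : {measure set T -> \bar R},
    m = positive_variation r :> (set T -> \bar R) /\
    forall A, measurable A -> m A \is a fin_num.
Proof.
move=> sr; have [P [N [mP mN rP _ _]]] := positive_variation_hahn sr.
have p0 : positive_variation r set0 = 0%E.
  by rewrite rP // set0I signed_measure0.
have pge0 A : (0 <= positive_variation r A)%E.
  by apply: ereal_sup_ubound; exists set0; [split|rewrite signed_measure0].
have psa : semi_sigma_additive (positive_variation r).
  move=> F mF tF mUF; rewrite rP // setI_bigcupl.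
  under eq_fun do under eq_bigr do rewrite rP //.
  apply: sr; first by move=> i; exact: measurableI.
    exact: trivIset_setIr.
  by apply: bigcup_measurable => i _; exact: measurableI.
pose m := isMeasure.Build d T R (positive_variation r) p0 pge0 psa.
pose m' : {measure set T -> \bar R} := HB.pack (positive_variation r) m.
by exists m'; split => // A mA; rewrite /m' /= rP.
Qed.
End jordan.

(** * Lower integrals *)

Section lower_integral.
Context d (T : measurableType d) (R : realType).
Implicit Types (m : {measure set T -> \bar R}) (f g : T -> R).
Import HBNNSimple.

Lemma finite_measure_fin_num m A : (m setT < +oo)%E -> measurable A ->
  m A \is a fin_num.
Proof.
by move=> fin mA; rewrite ge0_fin_numE // (le_lt_trans _ fin) // le_measure ?inE.
Qed.

(** The integral of a nonnegative function is by definition the supremum of the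
    integrals of the simple functions below it, so bounds on it can be checked on
    simple functions. *)
Lemma lower_integral_le m f (b : \bar R) : (forall x, 0 <= f x) ->
  (forall h : {nnsfun T >-> R}, (forall x, h x <= f x) ->
    (\int[m]_x (h x)%:E <= b)%E) ->
  (\int[m]_x (f x)%:E <= b)%E.
Proof.
move=> f0 H; rewrite ge0_integralTE; last by move=> x; rewrite lee_fin.
apply: ge_ereal_sup => _ [h hf <-]; rewrite -integralT_nnsfun.
by apply: H => x; have := hf x; rewrite lee_fin.
Qed.

Lemma lower_integral_mono m f g : (forall x, 0 <= f x) -> (forall x, f x <= g x) ->
  (\int[m]_x (f x)%:E <= \int[m]_x (g x)%:E)%E.
Proof.
move=> f0 fg; rewrite !ge0_integralTE; first last.
- by move=> x; rewrite lee_fin.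
- by move=> x; rewrite lee_fin (le_trans (f0 x)).
apply: le_ereal_sup => _ [h hf <-]; exists h => //= x.
by rewrite (le_trans (hf x)) // lee_fin.
Qed.

Lemma lower_integral_bounded m f M : (forall x, 0 <= f x) -> (forall x, f x <= M) ->
  (\int[m]_x (f x)%:E <= M%:E * m setT)%E.
Proof.
move=> f0 fM; rewrite -integral_cst //; exact: lower_integral_mono.
Qed.

(** Simple functions approximating [f] from below for [m1] and for [m2] can be
    replaced by their maximum, so the same functions approach both lower
    integrals.  This is what makes convolution additive in its right factor. *)
Lemma lower_integral_add m1 m2 m f M : (m1 setT < +oo)%E -> (m2 setT < +oo)%E ->
  (forall A, measurable A -> m A = m1 A + m2 A)%E ->
  (forall x, 0 <= f x) -> (forall x, f x <= M) ->
  (\int[m]_x (f x)%:E = \int[m1]_x (f x)%:E + \int[m2]_x (f x)%:E)%E.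
Proof.
move=> fin1 fin2 mE f0 fM.
have sadd (h : {nnsfun T >-> R}) :
    (\int[m]_x (h x)%:E = \int[m1]_x (h x)%:E + \int[m2]_x (h x)%:E)%E.
  rewrite -ge0_integral_measure_add //; last 2 first.
  - by move=> x _; rewrite lee_fin.
  - by apply/measurable_EFinP.
  apply: eq_measure_integral => A mA _; rewrite mE //.
  by rewrite -measure_addE.
have ge0 m' g : (forall x, 0 <= g x) -> (0 <= \int[m']_x (g x)%:E)%E.
  by move=> g0; apply: integral_ge0 => x _; rewrite lee_fin.
have finf (m' : {measure set T -> \bar R}) g : (m' setT < +oo)%E ->
    (forall x, 0 <= g x) -> (forall x, g x <= M) ->
    (\int[m']_x (g x)%:E)%E \is a fin_num.
  move=> fin' g0 gM; rewrite ge0_fin_numE ?ge0 //.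
  apply: le_lt_trans (lower_integral_bounded m' g0 gM) _.
  have /fineK <- : m' setT \is a fin_num by rewrite ge0_fin_numE.
  by rewrite -EFinM ltry.
have hM (h : {nnsfun T >-> R}) x : h x <= f x -> h x <= M.
  by move=> /le_trans; apply.
apply/eqP; rewrite eq_le; apply/andP; split.
  apply: lower_integral_le => // h hf; rewrite sadd.
  by apply: leeD; exact: lower_integral_mono.
rewrite -leeBrDr ?finf //; apply: lower_integral_le => // h1 h1f.
rewrite leeBrDr ?finf // addeC -leeBrDr ?finf //; last first.
  by move=> x; exact: hM.
apply: lower_integral_le => // h2 h2f; rewrite leeBrDr ?finf //; last first.
  by move=> x; exact: hM.
apply: (@le_trans _ _ (\int[m]_x (max_nnsfun h1 h2 x)%:E)%E); last first.
  by apply: lower_integral_mono => // x; rewrite /= ge_max h1f h2f.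
rewrite sadd addeC; apply: leeD; apply: lower_integral_mono => // x.
  by rewrite /= le_max lexx orbT.
by rewrite /= le_max lexx.
Qed.

Lemma lower_integral_scale m1 m (t : R) f : 0 <= t ->
  (forall A, measurable A -> m A = t%:E * m1 A)%E ->
  (forall x, 0 <= f x) ->
  (\int[m]_x (f x)%:E = t%:E * \int[m1]_x (f x)%:E)%E.
Proof.
move=> t0 mE f0.
have sscale (h : {nnsfun T >-> R}) :
    (\int[m]_x (h x)%:E = t%:E * \int[m1]_x (h x)%:E)%E.
  rewrite -(ge0_integral_mscale m1 measurableT (NngNum t0)) //; last 2 first.
  - by apply/measurable_EFinP.
  - by move=> x _; rewrite lee_fin.
  by apply: eq_measure_integral => A mA _; rewrite mE.
have [t00|tgt0] := eqVneq t 0.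
  rewrite t00 mul0e; apply/eqP; rewrite eq_le; apply/andP; split.
    by apply: lower_integral_le => // h hf; rewrite sscale t00 mul0e.
  by apply: integral_ge0 => x _; rewrite lee_fin.
have {}tgt0 : 0 < t by rewrite lt_neqAle eq_sym tgt0.
apply/eqP; rewrite eq_le; apply/andP; split.
  apply: lower_integral_le => // h hf; rewrite sscale.
  by rewrite lee_pmul2l ?fin_numE //; exact: lower_integral_mono.
rewrite muleC -lee_pdivlMr //; apply: lower_integral_le => // h hf.
by rewrite lee_pdivlMr // muleC -sscale; exact: lower_integral_mono.
Qed.

(** Both inequalities come from composing simple functions, with [phi] and with
    its inverse. *)
Lemma lower_integral_push m1 m (phi psi : T -> T) f :
  measurable_fun setT phi -> measurable_fun setT psi ->
  cancel phi psi -> cancel psi phi ->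
  (forall A, measurable A -> m A = m1 (phi @^-1` A)) ->
  (forall x, 0 <= f x) ->
  (\int[m]_x (f x)%:E = \int[m1]_x (f (phi x))%:E)%E.
Proof.
have le (m2 m3 : {measure set T -> \bar R}) (p : T -> T) g :
    measurable_fun setT p ->
    (forall A, measurable A -> m3 A = m2 (p @^-1` A)) -> (forall x, 0 <= g x) ->
    (\int[m3]_x (g x)%:E <= \int[m2]_x (g (p x))%:E)%E.
  move=> mp mE g0; apply: lower_integral_le => // h hg.
  have -> : (\int[m3]_x (h x)%:E = \int[pushforward m2 p]_x (h x)%:E)%E.
    by apply: eq_measure_integral => A mA _; rewrite mE.
  rewrite ge0_integral_pushforward //=; last 2 first.
  - by apply/measurable_EFinP.
  - by move=> x _; rewrite lee_fin.
  by rewrite preimage_setT; exact: lower_integral_mono.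
move=> mphi mpsi phiK psiK mE f0; apply/eqP; rewrite eq_le le //=.
have -> : (\int[m]_x (f x)%:E = \int[m]_x (f (phi (psi x)))%:E)%E.
  by apply: eq_integral => x _; rewrite psiK.
apply: (le m m1 psi (fun x => f (phi x))) => // A mA.
rewrite mE; last by rewrite -[_ @^-1` _]setTI; exact: mpsi.
by congr (m1 _); apply/funext => x /=; rewrite phiK.
Qed.

End lower_integral.

(** * Integration against a signed measure *)

Section signed_integral.
Context d (T : measurableType d) (R : realType).
Implicit Types (M : R) (m p q : {measure set T -> \bar R}) (f g : T -> R) (r s : set T -> R).

Lemma lower_integral_fin_num m f M : (m setT < +oo)%E -> (forall x, 0 <= f x <= M) ->
  (\int[m]_x (f x)%:E)%E \is a fin_num.
Proof.
move=> finm f0M; have f0 x : 0 <= f x by have /andP[] := f0M x.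
have fM x : f x <= M by have /andP[] := f0M x.
rewrite ge0_fin_numE; last by apply: integral_ge0 => x _; rewrite lee_fin.
apply: le_lt_trans (lower_integral_bounded m f0 fM) _.
have /fineK <- : m setT \is a fin_num by rewrite ge0_fin_numE.
by rewrite -EFinM ltry.
Qed.

Lemma fine_lower_integral_bounded m f M : (m setT < +oo)%E ->
  (forall x, 0 <= f x <= M) ->
  0 <= fine (\int[m]_x (f x)%:E)%E <= M * fine (m setT).
Proof.
move=> finm f0M; have f0 x : 0 <= f x by have /andP[] := f0M x.
have fM x : f x <= M by have /andP[] := f0M x.
have mfin : m setT \is a fin_num by rewrite ge0_fin_numE.
rewrite fine_ge0 /=; last by apply: integral_ge0 => x _; rewrite lee_fin.
rewrite -lee_fin EFinM !fineK //; first exact: lower_integral_bounded.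
exact: lower_integral_fin_num f0M.
Qed.

Definition pos_part f x := Num.max (f x) 0.
Definition neg_part f x := Num.max (- f x) 0.

Lemma pos_part_bounded f M : (forall x, `|f x| <= M) -> forall x, 0 <= pos_part f x <= M.
Proof.
move=> fM x; rewrite /pos_part le_max lexx orbT /= ge_max (le_trans _ (fM x)) ?ler_norm //.
by rewrite (le_trans _ (fM x)).
Qed.

Lemma neg_part_bounded f M : (forall x, `|f x| <= M) -> forall x, 0 <= neg_part f x <= M.
Proof.
by move=> fM; apply: (@pos_part_bounded (fun x => - f x)) => x; rewrite normrN.
Qed.

Lemma fine_integralE m f M : (m setT < +oo)%E -> (forall x, `|f x| <= M) ->
  fine (\int[m]_x (f x)%:E)%E =
  fine (\int[m]_x (pos_part f x)%:E)%E - fine (\int[m]_x (neg_part f x)%:E)%E.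
Proof.
move=> finm fM; rewrite integralE.
have -> : (\int[m]_x ((fun x => (f x)%:E)^\+ x) = \int[m]_x (pos_part f x)%:E)%E.
  by apply: eq_integral => x _; rewrite funepos.unlock /pos_part EFin_max.
have -> : (\int[m]_x ((fun x => (f x)%:E)^\- x) = \int[m]_x (neg_part f x)%:E)%E.
  by apply: eq_integral => x _; rewrite funeneg.unlock /neg_part EFin_max.
rewrite fineB //; apply: (lower_integral_fin_num (M := M)) => //.
  exact: pos_part_bounded.
exact: neg_part_bounded.
Qed.

Lemma fine_integral_add m1 m2 m f M : (m1 setT < +oo)%E -> (m2 setT < +oo)%E ->
  (forall A, measurable A -> m A = m1 A + m2 A)%E -> (forall x, `|f x| <= M) ->
  fine (\int[m]_x (f x)%:E)%E =
  fine (\int[m1]_x (f x)%:E)%E + fine (\int[m2]_x (f x)%:E)%E.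
Proof.
move=> fin1 fin2 mE fM.
have fin : (m setT < +oo)%E by rewrite mE // lte_add_pinfty.
have addp g : (forall x, 0 <= g x <= M) -> fine (\int[m]_x (g x)%:E)%E =
    fine (\int[m1]_x (g x)%:E)%E + fine (\int[m2]_x (g x)%:E)%E.
  move=> gM; have g0 x : 0 <= g x by have /andP[] := gM x.
  have g1 x : g x <= M by have /andP[] := gM x.
  rewrite (lower_integral_add fin1 fin2 mE g0 g1) fineD //;
    exact: lower_integral_fin_num gM.
rewrite !(fine_integralE _ fM) // !addp; [lra|exact: neg_part_bounded|exact: pos_part_bounded].
Qed.

Lemma fine_integral_scale m1 m t f M : (m1 setT < +oo)%E -> 0 <= t ->
  (forall A, measurable A -> m A = t%:E * m1 A)%E -> (forall x, `|f x| <= M) ->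
  fine (\int[m]_x (f x)%:E)%E = t * fine (\int[m1]_x (f x)%:E)%E.
Proof.
move=> fin1 t0 mE fM.
have fin : (m setT < +oo)%E.
  rewrite mE //; have /fineK <- : m1 setT \is a fin_num by rewrite ge0_fin_numE.
  by rewrite -EFinM ltry.
have scp g : (forall x, 0 <= g x <= M) ->
    fine (\int[m]_x (g x)%:E)%E = t * fine (\int[m1]_x (g x)%:E)%E.
  move=> gM; have g0 x : 0 <= g x by have /andP[] := gM x.
  rewrite (lower_integral_scale t0 mE g0) fineM //.
  exact: lower_integral_fin_num gM.
rewrite !(fine_integralE _ fM) // !scp; [lra|exact: neg_part_bounded|exact: pos_part_bounded].
Qed.

Lemma fine_integral_push m1 m (phi psi : T -> T) f M : (m1 setT < +oo)%E ->
  measurable_fun setT phi -> measurable_fun setT psi ->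
  cancel phi psi -> cancel psi phi ->
  (forall A, measurable A -> m A = m1 (phi @^-1` A)) -> (forall x, `|f x| <= M) ->
  fine (\int[m]_x (f x)%:E)%E = fine (\int[m1]_x (f (phi x))%:E)%E.
Proof.
move=> fin1 mphi mpsi phiK psiK mE fM.
have fin : (m setT < +oo)%E by rewrite mE // preimage_setT.
rewrite (fine_integralE fin fM) (fine_integralE (f := fun x => f (phi x)) fin1 (fun x => fM _)).
rewrite !(lower_integral_push mphi mpsi phiK psiK mE) // => x.
  by rewrite /neg_part le_max lexx orbT.
by rewrite /pos_part le_max lexx orbT.
Qed.

Lemma signed_jordan r : signed_measure r -> exists p q,
  [/\ p = positive_variation r :> (set T -> \bar R) /\
        q = positive_variation (fun A => - r A) :> (set T -> \bar R),
      (p setT < +oo)%E /\ (q setT < +oo)%E,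
      forall A, measurable A -> r A = fine (p A) - fine (q A),
      forall A, measurable A -> exists2 B, measurable B /\ B `<=` A & fine (p A) = r B &
      forall A, measurable A -> exists2 B, measurable B /\ B `<=` A & fine (q A) = - r B].
Proof.
move=> sr; have [mp [mpE mpfin]] := jordan_measure sr.
have [mn [mnE mnfin]] := jordan_measure (signed_measure_opp sr).
have [P [N [mP mN rP rN rPN]]] := positive_variation_hahn sr.
have lty m : m setT \is a fin_num -> (m setT < +oo)%E by rewrite ge0_fin_numE.
exists mp, mn; split=> //; first by split; apply: lty; [exact: mpfin|exact: mnfin].
- by move=> A mA; rewrite mpE mnE rP // rN //= rPN // opprK.
- move=> A mA; exists (A `&` P); last by rewrite mpE rP.
  by split; [exact: measurableI|exact: subIsetl].
- move=> A mA; exists (A `&` N); last by rewrite mnE rN.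
  by split; [exact: measurableI|exact: subIsetl].
Qed.

(** Any way of writing a signed measure as a difference of finite measures computes
    its integrals: adding the negative parts to both sides of [mp - mn = p - q]
    gives an equality of measures, to which additivity applies.  Linearity in the
    signed measure follows. *)
Lemma signed_integral_repr r p q f M : signed_measure r ->
  (p setT < +oo)%E -> (q setT < +oo)%E ->
  (forall A, measurable A -> r A = fine (p A) - fine (q A)) ->
  (forall x, `|f x| <= M) ->
  signed_integral r f = fine (\int[p]_x (f x)%:E)%E - fine (\int[q]_x (f x)%:E)%E.
Proof.
move=> sr finp finq rE fM.
have [mp [mn [[mpE mnE] [finmp finmn] rE' _ _]]] := signed_jordan sr.
rewrite /signed_integral -mpE -mnE.
have E A : measurable A -> (measure_add mp q A = measure_add mn p A)%E.
  move=> mA; rewrite !measure_addE.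
  rewrite -(fineK (finite_measure_fin_num finmp mA)) -(fineK (finite_measure_fin_num finq mA)).
  rewrite -(fineK (finite_measure_fin_num finmn mA)) -(fineK (finite_measure_fin_num finp mA)).
  by rewrite -!EFinD; congr (_%:E); have := rE A mA; have := rE' A mA; lra.
have E1 := fine_integral_add finmp finq (fun A _ => measure_addE mp q A) fM.
have E2 := fine_integral_add finmn finp (fun A _ => measure_addE mn p A) fM.
have : fine (\int[measure_add mp q]_x (f x)%:E)%E =
       fine (\int[measure_add mn p]_x (f x)%:E)%E.
  by congr fine; apply: eq_measure_integral => A mA _; exact: E.
move: E1 E2; lra.
Qed.

Lemma signed_integral_scale r t f M : signed_measure r -> (forall x, `|f x| <= M) ->
  signed_integral (fun A => t * r A) f = t * signed_integral r f.
Proof.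
move=> sr fM.
have str := signed_measure_scale (c := t) sr.
have [p [q [_ [finp finq] rE _ _]]] := signed_jordan sr.
have finZ (m : {measure set T -> \bar R}) (u : {nonneg R}) : (m setT < +oo)%E ->
    (mscale u m setT < +oo)%E.
  move=> fin; rewrite /mscale /=.
  have /fineK <- : m setT \is a fin_num by rewrite ge0_fin_numE.
  by rewrite -EFinM ltry.
have fineZ (m : {measure set T -> \bar R}) (u : {nonneg R}) A : (m setT < +oo)%E ->
    measurable A -> fine (mscale u m A) = u%:num * fine (m A).
  by move=> fin mA; rewrite /mscale /= fineM // finite_measure_fin_num.
have intZ (m : {measure set T -> \bar R}) (u : {nonneg R}) : (m setT < +oo)%E ->
    fine (\int[mscale u m]_x (f x)%:E)%E = u%:num * fine (\int[m]_x (f x)%:E)%E.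
  by move=> fin; apply: (fine_integral_scale (M := M)).
have [t0|t0] := leP 0 t.
  pose u := NngNum t0.
  rewrite (signed_integral_repr (M := M) str (finZ p u finp) (finZ q u finq)) //; last first.
    by move=> A mA; rewrite !fineZ // rE //= mulrBr.
  by rewrite !intZ // (signed_integral_repr (M := M) sr finp finq) //= mulrBr.
have t0' : 0 <= - t by lra.
pose u := NngNum t0'.
rewrite (signed_integral_repr (M := M) str (finZ q u finq) (finZ p u finp)) //; last first.
  by move=> A mA; rewrite !fineZ // rE //=; lra.
by rewrite !intZ // (signed_integral_repr (M := M) sr finp finq) //=; lra.
Qed.

Lemma signed_integral_add r s f M : signed_measure r -> signed_measure s ->
  (forall x, `|f x| <= M) ->
  signed_integral (fun A => r A + s A) f = signed_integral r f + signed_integral s f.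
Proof.
move=> sr ss fM.
have srs : signed_measure (fun A => r A + s A).
  have := signed_measure_lin (c := 1) sr ss.
  by congr signed_measure; apply/funext => A; lra.
have [p [q [_ [finp finq] rE _ _]]] := signed_jordan sr.
have [p' [q' [_ [finp' finq'] sE _ _]]] := signed_jordan ss.
have finD (m m' : {measure set T -> \bar R}) : (m setT < +oo)%E -> (m' setT < +oo)%E ->
    (measure_add m m' setT < +oo)%E.
  by move=> fin fin'; rewrite measure_addE lte_add_pinfty.
rewrite (signed_integral_repr (M := M) srs (finD _ _ finp finp') (finD _ _ finq finq')) //.
  rewrite (signed_integral_repr (M := M) sr finp finq) //.
  rewrite (signed_integral_repr (M := M) ss finp' finq') //.
  rewrite (fine_integral_add finp finp' (fun A _ => measure_addE p p' A) fM).
  rewrite (fine_integral_add finq finq' (fun A _ => measure_addE q q' A) fM).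
  lra.
move=> A mA.
have addE (m m' : {measure set T -> \bar R}) : (m setT < +oo)%E -> (m' setT < +oo)%E ->
    fine (measure_add m m' A) = fine (m A) + fine (m' A).
  by move=> fin fin'; rewrite measure_addE fineD // finite_measure_fin_num.
by rewrite (addE p p') // (addE q q') // rE // sE //; lra.
Qed.

Lemma signed_integral_indic r A : signed_measure r -> measurable A ->
  signed_integral r \1_A = r A.
Proof.
move=> sr mA; have [p [q [_ [finp finq] rE _ _]]] := signed_jordan sr.
rewrite (signed_integral_repr (M := 1) sr finp finq) //.
  by rewrite !integral_indic // !setIT rE.
by move=> x; rewrite indicE; case: (_ \in _); rewrite ?normr1 ?normr0.
Qed.

Lemma signed_integral_cst r c : signed_measure r ->
  signed_integral r (fun=> c) = c * r setT.
Proof.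
move=> sr; have [p [q [_ [finp finq] rE _ _]]] := signed_jordan sr.
rewrite (signed_integral_repr (M := `|c|) sr finp finq) //.
rewrite !(integral_cst _ measurableT) rE // !fineM //; last 2 first.
- by rewrite ge0_fin_numE.
- by rewrite ge0_fin_numE.
by rewrite mulrBr.
Qed.

Lemma signed_integral_bound r f M b : signed_measure r -> (forall x, `|f x| <= M) ->
  (forall A, measurable A -> `|r A| <= b) ->
  `|signed_integral r f| <= 4 * (M * b).
Proof.
move=> sr fM rb; have [p [q [_ [finp finq] rE pB qB]]] := signed_jordan sr.
have M0 : 0 <= M by apply: le_trans (fM point).
have int_le (m : {measure set T -> \bar R}) : (m setT < +oo)%E -> fine (m setT) <= b ->
    `|fine (\int[m]_x (f x)%:E)%E| <= 2 * (M * b).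
  move=> fin mb; rewrite (fine_integralE fin fM).
  have /andP[a1 a2] := fine_lower_integral_bounded fin (pos_part_bounded fM).
  have /andP[b1 b2] := fine_lower_integral_bounded fin (neg_part_bounded fM).
  have Mm : M * fine (m setT) <= M * b by rewrite ler_wpM2l.
  rewrite ler_norml; apply/andP; split; lra.
rewrite (signed_integral_repr (M := M) sr finp finq) //.
apply: le_trans (ler_normB _ _) _.
have ip : `|fine (\int[p]_x (f x)%:E)%E| <= 2 * (M * b).
  apply: int_le => //; have [B [mB _] ->] := pB _ measurableT.
  by rewrite (le_trans (ler_norm _)) // rb.
have iq : `|fine (\int[q]_x (f x)%:E)%E| <= 2 * (M * b).
  apply: int_le => //; have [B [mB _] ->] := qB _ measurableT.
  by rewrite (le_trans (ler_norm _)) // normrN rb.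
lra.
Qed.

Lemma signed_integral_push r (phi psi : T -> T) f M : signed_measure r ->
  measurable_fun setT phi -> measurable_fun setT psi ->
  cancel phi psi -> cancel psi phi -> (forall x, `|f x| <= M) ->
  signed_measure (fun A => r (phi @^-1` A)) /\
  signed_integral (fun A => r (phi @^-1` A)) f = signed_integral r (fun x => f (phi x)).
Proof.
move=> sr mphi mpsi phiK psiK fM.
have mpre A : measurable A -> measurable (phi @^-1` A).
  by move=> mA; rewrite -[_ @^-1` _]setTI; exact: mphi.
have srp : signed_measure (fun A => r (phi @^-1` A)).
  move=> F mF tF mUF; rewrite preimage_bigcup; apply: sr.
  - by move=> i; exact: mpre.
  - by move=> i j _ _ [x [Fix Fjx]]; apply: (tF i j) => //; exists (phi x).
  - by rewrite -preimage_bigcup; exact: mpre.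
split=> //; have [p [q [_ [finp finq] rE _ _]]] := signed_jordan sr.
have finP (m : {measure set T -> \bar R}) : (m setT < +oo)%E ->
    (pushforward m phi setT < +oo)%E.
  by rewrite /pushforward preimage_setT.
rewrite (signed_integral_repr (p := pushforward p phi) (q := pushforward q phi) (M := M)) //.
- rewrite (fine_integral_push finp mphi mpsi phiK psiK _ fM) //.
  rewrite (fine_integral_push finq mphi mpsi phiK psiK _ fM) //.
  by rewrite (signed_integral_repr (M := M) sr finp finq).
- by move=> A mA; rewrite rE //; exact: mpre.
Qed.

(** A function between [t 1_K] and [t 1_U] has integral close to [t r(K)] when [r]
    is small on [U \ K], because its lower integrals against both parts of [r] lie
    between those of these two functions. *)
Lemma signed_integral_squeeze r f t e (K U : set T) : signed_measure r ->
  measurable K -> measurable U -> K `<=` U -> 0 <= t ->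
  (forall x, 0 <= f x <= t) -> (forall x, K x -> f x = t) ->
  (forall x, ~ U x -> f x = 0) ->
  (forall S, measurable S -> S `<=` U `\` K -> `|r S| <= e) ->
  `|signed_integral r f - t * r K| <= t * e.
Proof.
move=> sr mK mU KU t0 f0t fK fU re.
have [p [q [_ [finp finq] rE pB qB]]] := signed_jordan sr.
have mUK : measurable (U `\` K) by exact: measurableD.
have f0 x : 0 <= f x by have /andP[] := f0t x.
have sandwich (m : {measure set T -> \bar R}) : (m setT < +oo)%E ->
    fine (m (U `\` K)) <= e ->
    t * fine (m K) <= fine (\int[m]_x (f x)%:E)%E <= t * fine (m K) + t * e.
  move=> fin me; have ffin A : measurable A -> m A \is a fin_num.
    exact: finite_measure_fin_num.
  have ind A : measurable A -> (\int[m]_x (t * \1_A x)%:E = (t * fine (m A))%:E)%E.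
    move=> mA; under eq_integral do rewrite EFinM.
    rewrite ge0_integralZl //; last by apply/measurable_EFinP.
    by rewrite integral_indic // setIT EFinM fineK ?ffin.
  have If : (\int[m]_x (f x)%:E)%E \is a fin_num by exact: lower_integral_fin_num f0t.
  have lo : (\int[m]_x (t * \1_K x)%:E <= \int[m]_x (f x)%:E)%E.
    apply: lower_integral_mono => x; first by rewrite mulr_ge0.
    rewrite indicE; case: (boolP (x \in K)) => xK; last by rewrite mulr0.
    by rewrite mulr1 fK //; move: xK; rewrite inE.
  have hi : (\int[m]_x (f x)%:E <= \int[m]_x (t * \1_U x)%:E)%E.
    apply: lower_integral_mono => // x.
    rewrite indicE; case: (boolP (x \in U)) => xU; first by rewrite mulr1; have /andP[] := f0t x.
    by rewrite mulr0 fU //; move: xU; rewrite notin_setE.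
  move: lo hi; rewrite !ind // -(fineK If) !lee_fin => -> hi /=.
  apply: (le_trans hi); rewrite -mulrDr ler_wpM2l //.
  have -> : m U = (m K + m (U `\` K))%E.
    rewrite -measureU //; last by rewrite setDIK.
    by rewrite setDUK.
  by rewrite fineD ?ffin // lerD2l.
have pe : fine (p (U `\` K)) <= e.
  have [B [mB BUK] ->] := pB _ mUK; exact: le_trans (ler_norm _) (re B mB BUK).
have qe : fine (q (U `\` K)) <= e.
  have [B [mB BUK] ->] := qB _ mUK; apply: le_trans (ler_norm _) _.
  by rewrite normrN re.
have /andP[p1 p2] := sandwich p finp pe; have /andP[q1 q2] := sandwich q finq qe.
rewrite (signed_integral_repr (M := t) sr finp finq) //; last first.
  by move=> x; rewrite ger0_norm //; have /andP[] := f0t x.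
rewrite rE // ler_norml; apply/andP; split; lra.
Qed.
End signed_integral.

(** * Complex measures and their integrals *)

Section complex_measures.
Context d (T : measurableType d) (R : realType).
Local Notation V := (@complex_set_fun R d T).
Implicit Types (mu nu : V) (f : T -> R[i]) (A B : set T).

Lemma Re_lin (c x y : R[i]) : complex.Re (c * x + y) =
  complex.Re c * complex.Re x + (- complex.Im c * complex.Im x + complex.Re y).
Proof. by case: c x y => [? ?] [? ?] [? ?] /=; ring. Qed.

Lemma Im_lin (c x y : R[i]) : complex.Im (c * x + y) =
  complex.Re c * complex.Im x + (complex.Im c * complex.Re x + complex.Im y).
Proof. by case: c x y => [? ?] [? ?] [? ?] /=; ring. Qed.

Lemma complex_measure_lin c mu nu : complex_measure mu -> complex_measure nu ->
  complex_measure (c *: mu + nu).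
Proof.
move=> [/= mr mi m0] [/= nr ni n0]; split.
- have := signed_measure_lin (c := complex.Re c) mr
    (signed_measure_lin (c := - complex.Im c) mi nr).
  by congr (semi_sigma_additive _); apply/funext => A; rewrite -Re_lin.
- have := signed_measure_lin (c := complex.Re c) mi
    (signed_measure_lin (c := complex.Im c) mr ni).
  by congr (semi_sigma_additive _); apply/funext => A; rewrite -Im_lin.
- by move=> A nA; rewrite (_ : (c *: mu + nu) A = c * mu A + nu A) // m0 // n0 // mulr0 addr0.
Qed.

Lemma complex_measure_zero : complex_measure (0 : V).
Proof.
have z : signed_measure (fun _ : set T => 0 : R).
  apply/signed_measureP => F _ _.
  rewrite (_ : series _ = cst 0); first exact: cvg_cst.
  by apply/funext => n; rewrite /series /= big1.
by split.
Qed.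

Lemma normc_bounded_ReIm f M : (forall x, normc (f x) <= M) ->
  (forall x, `|complex.Re (f x)| <= M) /\ (forall x, `|complex.Im (f x)| <= M).
Proof.
move=> fM; split => x; apply: le_trans (fM x); [exact: Re_le_normc|exact: Im_le_normc].
Qed.

Lemma signed_integral_lin (r s : set T -> R) c (g : T -> R) M : signed_measure r ->
  signed_measure s -> (forall x, `|g x| <= M) ->
  signed_integral (fun A => c * r A + s A) g = c * signed_integral r g + signed_integral s g.
Proof.
move=> sr ss gM.
by rewrite (signed_integral_add (signed_measure_scale (c := c) sr) ss gM)
  (signed_integral_scale c sr gM).
Qed.

Lemma complex_integral_lin c mu nu f M : complex_measure mu -> complex_measure nu ->
  (forall x, normc (f x) <= M) ->
  complex_integral (c *: mu + nu) f = c * complex_integral mu f + complex_integral nu f.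
Proof.
move=> [/= mr mi _] [/= nr ni _] /normc_bounded_ReIm[reM imM].
rewrite /complex_integral.
have ReE : (fun A => complex.Re ((c *: mu + nu) A)) = (fun A => complex.Re c *
    complex.Re (mu A) + (- complex.Im c * complex.Im (mu A) + complex.Re (nu A))).
  by apply/funext => A; rewrite -Re_lin.
have ImE : (fun A => complex.Im ((c *: mu + nu) A)) = (fun A => complex.Re c *
    complex.Im (mu A) + (complex.Im c * complex.Re (mu A) + complex.Im (nu A))).
  by apply/funext => A; rewrite -Im_lin.
have s1 := signed_measure_lin (c := - complex.Im c) mi nr.
have s2 := signed_measure_lin (c := complex.Im c) mr ni.
rewrite ReE ImE.
rewrite !(signed_integral_lin (complex.Re c) mr s1 reM) !(signed_integral_lin _ mi nr reM).
rewrite !(signed_integral_lin (complex.Re c) mr s1 imM) !(signed_integral_lin _ mi nr imM).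
rewrite !(signed_integral_lin (complex.Re c) mi s2 reM) !(signed_integral_lin _ mr ni reM).
rewrite !(signed_integral_lin (complex.Re c) mi s2 imM) !(signed_integral_lin _ mr ni imM).
apply/eqP; rewrite eq_complex; case: c {ReE ImE s1 s2} => a b /=.
by apply/andP; split; apply/eqP; ring.
Qed.

Lemma complex_integral_cst mu c : complex_measure mu ->
  complex_integral mu (fun=> c) = mu setT * c.
Proof.
move=> [/= mr mi _]; rewrite /complex_integral !signed_integral_cst //.
by case: c (mu setT) => [a b] [a' b'] /=; apply/eqP; rewrite eq_complex /=;
  apply/andP; split; apply/eqP; ring.
Qed.

Lemma complex_integral_indic mu A : complex_measure mu -> measurable A ->
  complex_integral mu (fun x => \1_A x) = mu A.
Proof.
move=> [/= mr mi _] mA; rewrite /complex_integral.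
have -> : (fun x => complex.Re (\1_A x : R[i])) = (\1_A : T -> R).
  by apply/funext => x; rewrite !indicE; case: (_ \in _).
have -> : (fun x => complex.Im (\1_A x : R[i])) = (fun=> 0).
  by apply/funext => x; rewrite !indicE; case: (_ \in _).
rewrite !signed_integral_indic // !signed_integral_cst // !mul0r subr0 add0r.
by case: (mu A).
Qed.

Lemma complex_integral_push mu (phi psi : T -> T) f M : complex_measure mu ->
  measurable_fun setT phi -> measurable_fun setT psi ->
  cancel phi psi -> cancel psi phi -> (forall x, normc (f x) <= M) ->
  complex_integral (fun A => mu (phi @^-1` A)) f = complex_integral mu (fun x => f (phi x)).
Proof.
move=> [/= mr mi _] mphi mpsi phiK psiK /normc_bounded_ReIm[reM imM].
rewrite /complex_integral.
have [_ e1] := signed_integral_push mr mphi mpsi phiK psiK reM.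
have [_ e2] := signed_integral_push mr mphi mpsi phiK psiK imM.
have [_ e3] := signed_integral_push mi mphi mpsi phiK psiK reM.
have [_ e4] := signed_integral_push mi mphi mpsi phiK psiK imM.
by rewrite -e1 -e2 -e3 -e4.
Qed.

Lemma complex_measure_push mu (phi psi : T -> T) : complex_measure mu ->
  measurable_fun setT phi -> measurable_fun setT psi ->
  cancel phi psi -> cancel psi phi ->
  complex_measure (fun A => mu (phi @^-1` A)).
Proof.
move=> [/= mr mi m0] mphi mpsi phiK psiK.
have b0 x : `|(fun _ : T => 0 : R) x| <= 0 by rewrite normr0.
split.
- by have [] := signed_integral_push mr mphi mpsi phiK psiK b0.
- by have [] := signed_integral_push mi mphi mpsi phiK psiK b0.
- move=> A nA; apply: m0 => mA; apply: nA.
  have -> : A = psi @^-1` (phi @^-1` A) by apply/funext => x /=; rewrite psiK.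
  by rewrite -[_ @^-1` _]setTI; exact: mpsi.
Qed.

(** This norm is equivalent to the total variation and suffices to bound
    convolutions. *)
Definition mass_norm mu : R := sup [set normc (mu A) | A in setT].

Lemma signed_measure_bounded (r : set T -> R) : signed_measure r ->
  exists b, forall A, measurable A -> `|r A| <= b.
Proof.
move=> sr; have [p [q [_ [finp finq] rE _ _]]] := signed_jordan sr.
exists (fine (p setT) + fine (q setT)) => A mA; rewrite rE //.
have le (m : {measure set T -> \bar R}) : (m setT < +oo)%E ->
    0 <= fine (m A) <= fine (m setT).
  move=> fin; have finA := finite_measure_fin_num fin mA.
  rewrite fine_ge0 //=; apply: fine_le => //; first by rewrite ge0_fin_numE.
  by apply: le_measure; rewrite ?inE.
have /andP[p1 p2] := le p finp; have /andP[q1 q2] := le q finq.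
rewrite ler_norml; apply/andP; split; lra.
Qed.

Section norm.
Variable mu : V.
Hypothesis cmu : complex_measure mu.

Let hasb : has_ubound [set normc (mu A) | A in setT].
Proof.
have [/= mr mi m0] := cmu; have [b rb] := signed_measure_bounded mr.
have [b' ib] := signed_measure_bounded mi; exists (b + b') => _ [A _ <-].
have [mA|nA] := pselect (measurable A).
  by apply: (le_trans (normc_le_ReIm _)); apply: lerD; [exact: rb|exact: ib].
rewrite m0 // normc0 addr_ge0 //.
  by apply: le_trans (rb _ measurable0).
by apply: le_trans (ib _ measurable0).
Qed.

Lemma mass_norm_ub A : normc (mu A) <= mass_norm mu.
Proof. by apply: ub_le_sup => //; exists A. Qed.

Lemma mass_norm_ge0 : 0 <= mass_norm mu.
Proof. exact: le_trans (normc_ge0 _) (mass_norm_ub set0). Qed.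

Lemma mass_norm_eq0 : mass_norm mu = 0 -> mu = 0.
Proof.
move=> N0; apply/funext => A; apply: eq0_normc; apply/eqP.
by rewrite eq_le normc_ge0 andbT -N0 mass_norm_ub.
Qed.
End norm.

Lemma mass_norm_le mu b : (forall A, normc (mu A) <= b) -> mass_norm mu <= b.
Proof.
move=> mub; apply: ge_sup; first by exists (normc (mu set0)); exists set0.
by move=> _ [A _ <-].
Qed.

Lemma mass_normD mu nu : complex_measure mu -> complex_measure nu ->
  mass_norm (mu + nu) <= mass_norm mu + mass_norm nu.
Proof.
move=> cmu cnu; apply: mass_norm_le => A.
apply: (@le_trans _ _ (normc (mu A) + normc (nu A))); first exact: le_normcD.
by apply: lerD; exact: mass_norm_ub.
Qed.

Lemma mass_normZ c mu : complex_measure mu ->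
  mass_norm (c *: mu) = normc c * mass_norm mu.
Proof.
have le a nu : complex_measure nu -> mass_norm (a *: nu) <= normc a * mass_norm nu.
  move=> cnu; apply: mass_norm_le => A.
  rewrite (_ : (a *: nu) A = a * nu A) // normcM ler_wpM2l ?normc_ge0 //.
  exact: mass_norm_ub.
move=> cmu; apply/eqP; rewrite eq_le le //=.
have [->|c0] := eqVneq c 0.
  rewrite normc0 mul0r mass_norm_ge0 // scale0r; exact: complex_measure_zero.
have ccmu : complex_measure (c *: mu).
  by rewrite -[c *: mu]addr0; apply: complex_measure_lin => //; exact: complex_measure_zero.
have := le c^-1 (c *: mu) ccmu; rewrite scalerA mulVf // scale1r normcV.
rewrite -ler_pdivlMl ?invr_gt0 ?invrK //.
rewrite lt_neqAle normc_ge0 andbT eq_sym; apply/eqP => /eq0_normc e.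
by rewrite e eqxx in c0.
Qed.

(** The constant 16 comes from four signed integrals, each of which splits into
    four by the signs of the function and of the measure. *)
Lemma complex_integral_bound mu f M : complex_measure mu ->
  (forall x, normc (f x) <= M) ->
  normc (complex_integral mu f) <= 16 * (M * mass_norm mu).
Proof.
move=> cmu /normc_bounded_ReIm[reM imM]; have [mr mi _] := cmu.
have rb A : measurable A -> `|complex.Re (mu A)| <= mass_norm mu.
  by move=> _; apply: le_trans (Re_le_normc _) (mass_norm_ub cmu A).
have ib A : measurable A -> `|complex.Im (mu A)| <= mass_norm mu.
  by move=> _; apply: le_trans (Im_le_normc _) (mass_norm_ub cmu A).
apply: le_trans (normc_le_ReIm _) _; rewrite /complex_integral /=.
have b1 := signed_integral_bound mr reM rb.
have b2 := signed_integral_bound mr imM rb.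
have b3 := signed_integral_bound mi reM ib.
have b4 := signed_integral_bound mi imM ib.
apply: le_trans (lerD (ler_normB _ _) (ler_normD _ _)) _; lra.
Qed.

End complex_measures.

(** * Translations and convolution *)

Section translations.
Context (R : realType) (G : topologicalGroupType).
Local Notation T := (borelType G).
Local Notation V := (@complex_set_fun R _ T).
Implicit Types (mu nu : V) (x y : G) (A : set G).

Lemma lmul_continuous x : continuous (fun y : G => (x * y)%g).
Proof.
move=> y; apply: (@continuous_comp _ _ _ (fun y : G => (x, y)) (fun p : G * G => (p.1 * p.2)%g)).
  by apply: cvg_pair => //; exact: cvg_cst.
exact: mulg_continuous.
Qed.

Lemma rmul_continuous x : continuous (fun y : G => (y * x)%g).
Proof.
move=> y; apply: (@continuous_comp _ _ _ (fun y : G => (y, x)) (fun p : G * G => (p.1 * p.2)%g)).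
  by apply: cvg_pair => //; exact: cvg_cst.
exact: mulg_continuous.
Qed.

Arguments lmul_continuous : clear implicits.
Arguments rmul_continuous : clear implicits.

Lemma continuous_borel (phi : G -> G) : continuous phi ->
  measurable_fun setT (phi : T -> T).
Proof.
move=> cphi; apply: (@measurability _ _ T T setT (phi : T -> T) (@open G)) => //.
move=> _ [B oB <-]; rewrite setTI; apply: sub_sigma_algebra.
by move/continuousP : cphi; apply.
Qed.

Lemma borel_preimage (phi : G -> G) A : continuous phi ->
  measurable (A : set T) -> measurable (phi @^-1` A : set T).
Proof. by move=> /continuous_borel mphi mA; rewrite -[_ @^-1` _]setTI; exact: mphi. Qed.

Lemma open_borel A : open A -> measurable (A : set T).
Proof. exact: sub_sigma_algebra. Qed.

Definition translate x mu : V := fun A => mu ((fun y : G => (x * y)%g) @^-1` A).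

Lemma lmulK x : cancel (fun y : G => (x * y)%g) (fun y : G => (x^-1 * y)%g).
Proof. by move=> y; rewrite mulKg. Qed.

Lemma lmulVK x : cancel (fun y : G => (x^-1 * y)%g) (fun y : G => (x * y)%g).
Proof. by move=> y; rewrite mulVKg. Qed.

Lemma translate_lin x c mu nu :
  translate x (c *: mu + nu) = c *: translate x mu + translate x nu.
Proof. by []. Qed.

Lemma translate_complex_measure x mu : complex_measure mu -> complex_measure (translate x mu).
Proof.
move=> cmu.
apply: (@complex_measure_push _ T R mu (fun y : G => (x * y)%g)
  (fun y : G => (x^-1 * y)%g)) => //; [| |exact: lmulK|exact: lmulVK];
  by apply: continuous_borel; exact: lmul_continuous.
Qed.

Lemma preimage_lmulV x A :
  (fun y : G => (x * y)%g) @^-1` ((fun y : G => (x^-1 * y)%g) @^-1` A) = A.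
Proof. by apply/funext => y /=; rewrite mulKg. Qed.

Lemma mass_norm_translate x mu : complex_measure mu ->
  mass_norm (translate x mu) = mass_norm mu.
Proof.
move=> cmu; apply/eqP; rewrite eq_le; apply/andP; split; apply: mass_norm_le => A.
  exact: (mass_norm_ub cmu).
rewrite -(preimage_lmulV x A); apply: (mass_norm_ub (translate_complex_measure x cmu)).
Qed.

(** The inner integral is that of an indicator, hence a value of [mu].  The outer
    one is left as it is: [y |-> mu (A y^-1)] is only ever treated as a bounded
    function. *)
Lemma convolutionE mu nu A : complex_measure mu -> measurable (A : set T) ->
  convolution mu nu A =
  complex_integral nu (fun y : G => mu ((fun x : G => (x * y)%g) @^-1` A)).
Proof.
move=> cmu mA; rewrite /convolution patchT ?inE //; congr complex_integral.
apply/funext => y; rewrite -(complex_integral_indic cmu) //.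
by apply: borel_preimage mA; exact: rmul_continuous.
Qed.

Lemma convolution_notmeas mu nu A : ~ measurable (A : set T) -> convolution mu nu A = 0.
Proof. by move=> nA; rewrite /convolution patchN // notin_setE. Qed.

Lemma convolution_lin mu c nu1 nu2 : complex_measure mu ->
  complex_measure nu1 -> complex_measure nu2 ->
  convolution mu (c *: nu1 + nu2) = c *: convolution mu nu1 + convolution mu nu2.
Proof.
move=> cmu c1 c2; apply/funext => A.
rewrite [RHS](_ : _ = c * convolution mu nu1 A + convolution mu nu2 A) //.
have [mA|nA] := pselect (measurable (A : set T)).
  rewrite !convolutionE //; apply: (@complex_integral_lin _ _ _ c nu1 nu2 _ (mass_norm mu)) => // y.
  exact: mass_norm_ub.
by rewrite !convolution_notmeas // mulr0 addr0.
Qed.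

Lemma convolution_setT mu nu : complex_measure mu -> complex_measure nu ->
  convolution mu nu setT = mu setT * nu setT.
Proof.
move=> cmu cnu; rewrite convolutionE //.
rewrite [LHS](_ : _ = complex_integral nu (fun=> mu setT)) //.
by rewrite complex_integral_cst // mulrC.
Qed.

Lemma convolution_bound mu nu : complex_measure mu -> complex_measure nu ->
  mass_norm (convolution mu nu) <= 16 * mass_norm mu * mass_norm nu.
Proof.
move=> cmu cnu; apply: mass_norm_le => A.
have [mA|nA] := pselect (measurable (A : set T)); last first.
  by rewrite convolution_notmeas // normc0 !mulr_ge0 // mass_norm_ge0.
rewrite convolutionE // -mulrA; apply: (@complex_integral_bound _ _ _ nu _ (mass_norm mu)) => // y.
exact: mass_norm_ub.
Qed.

(** Translating the left factor translates the set in the inner integral only, so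
    the two sides agree integrand by integrand. *)
Lemma translate_convolutionl x mu nu : complex_measure mu ->
  translate x (convolution mu nu) = convolution (translate x mu) nu.
Proof.
move=> cmu; apply/funext => A.
have lc := lmul_continuous; rewrite {1}/translate.
have [mA|nA] := pselect (measurable (A : set T)); last first.
  rewrite !convolution_notmeas // => mA; apply: nA.
  by rewrite -(preimage_lmulV (x^-1)%g A) invgK; exact: borel_preimage.
rewrite !convolutionE //; [|exact: translate_complex_measure|exact: borel_preimage].
congr complex_integral; apply/funext => y; rewrite /translate; congr (mu _).
by apply/funext => z /=; rewrite mulgA.
Qed.

(** Here the outer variable is changed, and commutativity moves [x] past it. *)
Lemma translate_convolutionr x mu nu : (forall x y : G, (x * y = y * x)%g) ->
  complex_measure mu -> complex_measure nu ->
  translate x (convolution mu nu) = convolution mu (translate x nu).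
Proof.
move=> com cmu cnu; rewrite translate_convolutionl //; apply/funext => A.
have [mA|nA] := pselect (measurable (A : set T)); last by rewrite !convolution_notmeas.
rewrite !convolutionE //; last exact: translate_complex_measure.
have := @complex_integral_push _ _ _ nu _ _
  (fun y : G => mu ((fun z : G => (z * y)%g) @^-1` A)) (mass_norm mu) cnu
  (continuous_borel (lmul_continuous x)) (continuous_borel (lmul_continuous (x^-1)%g))
  (lmulK x) (lmulVK x) (fun y => mass_norm_ub cmu _).
rewrite /translate => ->; congr complex_integral; apply/funext => y.
by congr (mu _); apply/funext => z /=; rewrite mulgA [(z * x)%g]com.
Qed.

End translations.

(** * A criterion for compactness *)

Section compactness.
Context (R : realType) (G : topologicalGroupType).
Hypothesis hausdorffG : hausdorff_space G.
Local Notation T := (borelType G).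
Local Notation V := (@complex_set_fun R _ T).

Lemma compact_borel (K : set G) : compact K -> measurable (K : set T).
Proof.
move=> cK; rewrite -[K]setCK; apply: measurableC; apply: open_borel.
by apply: closed_openC; exact: compact_closed.
Qed.

Lemma compact_mulV (K : set G) : compact K ->
  compact [set (p.1 * p.2^-1)%g | p in K `*` K].
Proof.
move=> cK; apply: continuous_compact; last exact: compact_setX.
apply: continuous_subspaceT => p.
apply: (@continuous_comp _ _ _ (fun p : G * G => (p.1, p.2^-1%g)) (fun p : G * G => (p.1 * p.2)%g)).
  apply: cvg_pair; first exact: cvg_fst.
  apply: (@continuous_comp _ _ _ snd (fun x : G => x^-1%g)); first exact: cvg_snd.
  exact: invg_continuous.
exact: mulg_continuous.
Qed.

(** In a noncompact group finitely many translates of the compact set [K K^-1] do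
    not cover, so there are infinitely many disjoint translates of [K].  Their
    masses have constant modulus, but would tend to 0 by sigma-additivity. *)
Lemma compact_of_eigenmeasure (mu : V) (K : set G) : complex_measure mu ->
  compact K -> mu K <> 0 ->
  (forall x, exists2 c, normc c = 1 & translate x mu = c *: mu) ->
  compact [set: G].
Proof.
move=> cmu cK muK eig; apply: contrapT => ncG.
pose Q := [set (p.1 * p.2^-1)%g | p in K `*` K].
pose U (s : seq G) := foldr (fun z acc => ((fun y : G => (y * z)%g) @` Q) `|` acc) set0 s.
have cU s : compact (U s).
  elim: s => [|z s IH] /=; first exact: compact0.
  apply: compactU => //; apply: continuous_compact; last exact: compact_mulV.
  by apply: continuous_subspaceT; exact: rmul_continuous.
have [f fU] : exists f : seq G -> G, forall s, ~ U s (f s).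
  suff /choice[f fP] : forall s, exists x, ~ U s x by exists f.
  move=> s; apply: contrapT => all.
  apply: ncG; have -> : [set: G] = U s.
    apply/seteqP; split => x _ //; apply: contrapT => Ux; apply: all; by exists x.
  exact: cU.
have UP s z w : z \in s -> Q w -> U s (w * z)%g.
  elim: s => [//|z' s IH]; rewrite inE => /orP[/eqP <-|zs] Qw /=.
    by left; exists w.
  by right; exact: IH.
(* [x n] avoids [K K^-1 x i] for [i < n], which makes [(x n)^-1 K] disjoint from
   [(x i)^-1 K]. *)
pose s n := iter n (fun s => f s :: s) [::].
pose x n := f (s n).
have xs i n : (i < n)%N -> x i \in s n.
  elim: n => // n IH; rewrite ltnS leq_eqVlt => /orP[/eqP ->|/IH xin].
    by rewrite /s /= inE eqxx.
  by rewrite /s /= inE xin orbT.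
pose F n := (fun y : G => (x n * y)%g) @^-1` K.
have Fdisj i n : (i < n)%N -> F i `&` F n = set0.
  move=> ilen; apply/seteqP; split => // y [Fi Fn]; apply: (fU (s n)).
  have -> : f (s n) = ((x n * y) * (x i * y)^-1 * x i)%g.
    by rewrite invgM mulgA mulgK mulgVK.
  by apply: UP; [exact: xs|exists ((x n * y)%g, (x i * y)%g)].
have tF : trivIset setT F.
  apply: ltn_trivIset => n i; exact: Fdisj.
have mF n : measurable (F n : set T).
  by apply: borel_preimage; [exact: lmul_continuous|exact: compact_borel].
have FE n : exists2 c, normc c = 1 & mu (F n) = c * mu K.
  have [c c1 e] := eig (x n); exists c => //.
  by have := congr1 (fun m : V => m K) e.
have NF n : normc (mu (F n)) = normc (mu K).
  by have [c c1 ->] := FE n; rewrite normcM c1 mul1r.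
have d0 : 0 < normc (mu K).
  by rewrite lt_neqAle normc_ge0 andbT eq_sym; apply/eqP => /eq0_normc.
have [mr mi _] := cmu.
have to0 (r : set T -> R) : signed_measure r -> (r \o F) @ \oo --> (0 : R).
  move=> /signed_measureP sr; apply: cvg_series_cvg_0; apply/cvg_ex.
  by exists (r (\bigcup_n F n)); exact: sr.
have h0 : 0 < normc (mu K) / 2 by rewrite divr_gt0.
have /cvgr0Pnorm_lt /(_ _ h0) H1 := to0 _ mr.
have /cvgr0Pnorm_lt /(_ _ h0) H2 := to0 _ mi.
near \oo => n.
have : normc (mu (F n)) < normc (mu K) / 2 + normc (mu K) / 2.
  apply: le_lt_trans (normc_le_ReIm _) _; apply: ltrD.
    by near: n; exact: H1.
  by near: n; exact: H2.
by rewrite NF -splitr ltxx.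
Unshelve. all: by end_near. Qed.
End compactness.

(** * The variation of a complex measure *)

Section variation.
Context d (T : measurableType d) (R : realType).
Local Notation V := (@complex_set_fun R d T).
Implicit Types (mu nu : V) (A B : set T).

Lemma complex_measureU mu A B : complex_measure mu -> measurable A -> measurable B ->
  A `&` B = set0 -> mu (A `|` B) = mu A + mu B.
Proof.
move=> [mr mi _] mA mB AB.
have := signed_measureU mr mA mB AB; have := signed_measureU mi mA mB AB.
by case: (mu A) (mu B) (mu (A `|` B)) => [? ?] [? ?] [? ?] /= -> ->.
Qed.

Lemma complex_variation_ub mu A (F : (set T)^nat) :
  (forall i, measurable (F i)) -> trivIset setT F -> \bigcup_i F i = A ->
  (\sum_(0 <= i <oo) (normc (mu (F i)))%:E <= complex_variation mu A)%E.
Proof. by move=> mF tF FA; apply: ereal_sup_ubound; exists F. Qed.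

Lemma complex_variation_le mu A (b : \bar R) :
  (forall F : (set T)^nat, (forall i, measurable (F i)) -> trivIset setT F ->
    \bigcup_i F i = A -> (\sum_(0 <= i <oo) (normc (mu (F i)))%:E <= b)%E) ->
  (complex_variation mu A <= b)%E.
Proof. by move=> H; apply: ge_ereal_sup => _ [F [mF tF FA] <-]; exact: H. Qed.

Lemma normc_le_variation mu A : measurable A ->
  ((normc (mu A))%:E <= complex_variation mu A)%E.
Proof.
move=> mA; pose F i : set T := if i is 0 then A else set0.
have FA : \bigcup_i F i = A.
  by apply/seteqP; split => [x [[|i]]//|x Ax]; exists 0%N.
apply: le_trans (complex_variation_ub (F := F) _ _ _ FA).
- apply: le_trans (nneseries_lim_ge 1 _) => [|i _ _]; last by rewrite lee_fin normc_ge0.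
  by rewrite big_nat1.
- by move=> [|i] //=.
- by move=> [|i] [|j] //= _ _ [x []].
Qed.

Lemma complex_variation_ge0 mu A : measurable A ->
  (0 <= complex_variation mu A)%E.
Proof.
move=> mA; apply: le_trans (normc_le_variation mu mA).
by rewrite lee_fin normc_ge0.
Qed.

Lemma complex_variation_fin mu A : complex_measure mu -> measurable A ->
  complex_variation mu A \is a fin_num.
Proof.
move=> cmu mA; have [mr mi _] := cmu; rewrite ge0_fin_numE ?complex_variation_ge0 //.
have [p [q [_ [finp finq] rE _ _]]] := signed_jordan mr.
have [p' [q' [_ [finp' finq'] iE _ _]]] := signed_jordan mi.
pose m : {measure set T -> \bar R} := measure_add (measure_add p q) (measure_add p' q').
have mE B : m B = ((p B + q B) + (p' B + q' B))%E.
  rewrite [LHS](measure_addE (measure_add p q) (measure_add p' q') B).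
  by congr (_ + _)%E; exact: measure_addE.
have finm : (m setT < +oo)%E by rewrite mE !lte_add_pinfty.
have mub B : measurable B -> ((normc (mu B))%:E <= m B)%E.
  move=> mB; rewrite mE; apply: (@le_trans _ _ (`|complex.Re (mu B)| + `|complex.Im (mu B)|)%:E).
    by rewrite lee_fin normc_le_ReIm.
  rewrite rE // iE //.
  rewrite -(fineK (finite_measure_fin_num finp mB)) -(fineK (finite_measure_fin_num finq mB)).
  rewrite -(fineK (finite_measure_fin_num finp' mB)) -(fineK (finite_measure_fin_num finq' mB)) -!EFinD lee_fin /=.
  have f0 (m' : {measure set T -> \bar R}) : `|fine (m' B)| = fine (m' B).
    by rewrite ger0_norm // fine_ge0.
  apply: lerD; apply: (le_trans (ler_normB _ _)); by rewrite !f0.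
apply: (@le_lt_trans _ _ (m A)); last first.
  by apply: le_lt_trans finm; rewrite le_measure ?inE.
apply: complex_variation_le => F mF tF FA.
rewrite -FA measure_bigcup //.
have -> : (\sum_(0 <= i <oo | i \in [set: nat]) m (F i) = \sum_(0 <= i <oo) m (F i))%E.
  by apply: eq_eseriesl => i; rewrite in_setT.
by apply: lee_nneseries => [i _ _|i _]; [by rewrite lee_fin normc_ge0|exact: mub].
Qed.

Lemma complex_variation_superadd mu A B : complex_measure mu ->
  measurable A -> measurable B -> A `&` B = set0 ->
  (complex_variation mu A + complex_variation mu B <= complex_variation mu (A `|` B))%E.
Proof.
move=> cmu mA mB AB.
rewrite -leeBrDr ?complex_variation_fin //.
apply: complex_variation_le => F mF tF FA.
rewrite leeBrDr ?complex_variation_fin // addeC.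
have finF : (\sum_(0 <= i <oo) (normc (mu (F i)))%:E)%E \is a fin_num.
  rewrite ge0_fin_numE; last first.
    by apply: nneseries_ge0 => i _ _; rewrite lee_fin normc_ge0.
  apply: (@le_lt_trans _ _ (complex_variation mu A)); first exact: complex_variation_ub.
  by rewrite -ge0_fin_numE ?complex_variation_ge0 // complex_variation_fin.
rewrite -leeBrDr //; apply: complex_variation_le => H mH tH HB.
rewrite leeBrDr // -nneseriesD //; last 2 first.
- by move=> i _ _; rewrite lee_fin normc_ge0.
- by move=> i _ _; rewrite lee_fin normc_ge0.
(* Interleaving a partition of [A] with one of [B] partitions their union. *)
pose W n := if odd n then H n./2 else F n./2.
have mW n : measurable (W n) by rewrite /W; case: ifP.
have tW : trivIset setT W.
  have FHdisj a b : F a `&` H b = set0.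
    apply/seteqP; split => // x [Fx Hx].
    by rewrite -AB -FA -HB; split; [exists a|exists b].
  move=> i j _ _; rewrite /W.
  case: ifPn => oi; case: ifPn => oj [x [Wi Wj]].
  - have e : i./2 = j./2 by apply: tH => //; exists x.
    by rewrite -(odd_double_half i) -(odd_double_half j) e oi oj.
  - by have : (F j./2 `&` H i./2) x by []; rewrite FHdisj.
  - by have : (F i./2 `&` H j./2) x by []; rewrite FHdisj.
  - have e : i./2 = j./2 by apply: tF => //; exists x.
    by rewrite -(odd_double_half i) -(odd_double_half j) e (negbTE oi) (negbTE oj).
have WAB : \bigcup_i W i = A `|` B.
  rewrite -FA -HB; apply/seteqP; split => x.
    by move=> [i _]; rewrite /W; case: ifP => _ Wx; [right|left]; exists i./2.
  case=> [[i _ Fx]|[i _ Hx]].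
    by exists i.*2 => //; rewrite /W odd_double doubleK.
  by exists i.*2.+1 => //; rewrite /W /= odd_double /= uphalf_double.
apply: (le_trans _ (complex_variation_ub mu mW tW WAB)).
apply: lime_le.
  by apply: is_cvg_nneseries => n _ _; rewrite adde_ge0 ?lee_fin ?normc_ge0.
apply: nearW => n.
have -> : (\sum_(0 <= i < n) ((normc (mu (H i)))%:E + (normc (mu (F i)))%:E) =
    \sum_(0 <= i < n.*2) (normc (mu (W i)))%:E)%E.
  elim: n => [|n IH]; first by rewrite !big_geq.
  rewrite doubleS big_nat_recr //= IH !big_nat_recr //= -addeA; congr (_ + _)%E.
  by rewrite /W /= odd_double /= doubleK uphalf_double addeC.
by apply: nneseries_lim_ge => i _ _; rewrite lee_fin normc_ge0.
Qed.

Lemma complex_variation_split mu A B : complex_measure mu ->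
  measurable A -> measurable B -> B `<=` A ->
  (complex_variation mu A <= complex_variation mu B + complex_variation mu (A `\` B))%E.
Proof.
move=> cmu mA mB BA; apply: complex_variation_le => F mF tF FA.
have mFB i : measurable (F i `&` B) by exact: measurableI.
have mFD i : measurable (F i `\` B) by exact: measurableD.
apply: (@le_trans _ _ (\sum_(0 <= i <oo) ((normc (mu (F i `&` B)))%:E +
    (normc (mu (F i `\` B)))%:E))%E).
  apply: lee_nneseries => [i _ _|i _]; first by rewrite lee_fin normc_ge0.
  rewrite -EFinD lee_fin.
  rewrite -{1}(setUIDK (F i) B) complex_measureU //; first exact: le_normcD.
  by rewrite setDE setIACA setICr setI0.
rewrite nneseriesD //; last 2 first.
- by move=> i _ _; rewrite lee_fin normc_ge0.
- by move=> i _ _; rewrite lee_fin normc_ge0.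
apply: leeD; apply: complex_variation_ub => //.
- exact: trivIset_setIr.
- by rewrite -setI_bigcupl FA; apply/setIidPr.
- by move=> i j _ _ [x [[Fi _] [Fj _]]]; apply: tF => //; exists x.
- by rewrite -setD_bigcupl FA.
Qed.

Lemma complex_variationD mu A B : complex_measure mu ->
  measurable A -> measurable B -> B `<=` A ->
  complex_variation mu A =
    (complex_variation mu B + complex_variation mu (A `\` B))%E.
Proof.
move=> cmu mA mB BA; apply/eqP; rewrite eq_le complex_variation_split //=.
rewrite -{2}(setDUK BA); apply: complex_variation_superadd => //.
  exact: measurableD.
by rewrite setDIK.
Qed.

Lemma complex_variation_mono mu A B : complex_measure mu ->
  measurable A -> measurable B -> B `<=` A ->
  (complex_variation mu B <= complex_variation mu A)%E.
Proof.
move=> cmu mA mB BA; rewrite (complex_variationD cmu mA mB BA) leeDl //.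
by apply: complex_variation_ge0 => //; exact: measurableD.
Qed.

Lemma complex_variation_lin c mu nu A :
  complex_measure mu -> complex_measure nu -> measurable A ->
  (complex_variation (c *: mu + nu)%R A <=
    (normc c)%:E * complex_variation mu A + complex_variation nu A)%E.
Proof.
move=> cmu cnu mA; apply: complex_variation_le => F mF tF FA.
apply: (@le_trans _ _ (\sum_(0 <= i <oo) ((normc c)%:E * (normc (mu (F i)))%:E +
    (normc (nu (F i)))%:E))%E).
  apply: lee_nneseries => [i _ _|i _]; first by rewrite lee_fin normc_ge0.
  rewrite -EFinM -EFinD lee_fin.
  rewrite -normcM; exact: le_normcD.
rewrite nneseriesD //; last 2 first.
- by move=> i _ _; rewrite -EFinM lee_fin mulr_ge0 ?normc_ge0.
- by move=> i _ _; rewrite lee_fin normc_ge0.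
rewrite nneseriesZl //; last by move=> i _; rewrite lee_fin normc_ge0.
apply: leeD; last exact: complex_variation_ub.
rewrite lee_wpmul2l ?lee_fin ?normc_ge0 //; exact: complex_variation_ub.
Qed.
End variation.

(** * The measure algebra *)

Section measure_algebra.
Context (R : realType) (G : topologicalGroupType).
Hypothesis hausdorffG : hausdorff_space G.
Local Notation T := (borelType G).
Local Notation V := (@complex_set_fun R _ T).
Implicit Types (mu nu : V).

Definition outer_regular mu := forall (A : set T) (e : R), measurable A -> 0 < e ->
  exists U : set G, [/\ open U, (A : set G) `<=` U &
    (complex_variation mu ((U : set T) `\` A) <= e%:E)%E].

Definition inner_regular mu := forall (U : set G) (e : R), open U -> 0 < e ->
  exists K : set G, [/\ compact K, K `<=` U &
    (complex_variation mu ((U : set T) `\` (K : set T)) <= e%:E)%E].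

(** The variation is finite and additive, so sets whose variations are close are
    sets whose difference has small variation.  The latter form passes to linear
    combinations. *)
Lemma radon_variationP mu : complex_measure mu ->
  radon (complex_variation mu) <-> outer_regular mu /\ inner_regular mu.
Proof.
move=> cmu; have cb := compact_borel hausdorffG.
have vfin (A : set T) : measurable A -> complex_variation mu A \is a fin_num.
  exact: complex_variation_fin.
split=> [[_ outer inner]|[outer inner]].
- split.
  + move=> A e mA e0.
    have fA : ereal_inf [set complex_variation mu U | U in
        [set U : set T | open (U : set G) /\ A `<=` U]] \is a fin_num.
      by rewrite -outer // vfin.
    have [_ [U [oU AU] <-]] := lb_ereal_inf_adherent e0 fA.
    rewrite -outer // => lt; exists U; split=> //.
    have mU := open_borel oU; move: lt; rewrite (complex_variationD cmu mU mA AU).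
    have /fineK <- := vfin _ mA.
    have /fineK <- : complex_variation mu ((U : set T) `\` A) \is a fin_num.
      by apply: vfin; exact: measurableD.
    rewrite -!EFinD lte_fin lee_fin; lra.
  + move=> U e oU e0.
    have mU := open_borel oU.
    have fU : ereal_sup [set complex_variation mu K | K in
        [set K : set T | compact (K : set G) /\ K `<=` U]] \is a fin_num.
      by rewrite -inner // vfin.
    have [_ [K [cK KU] <-]] := ub_ereal_sup_adherent e0 fU.
    rewrite -inner // => lt; exists K; split=> //.
    have mK := cb _ cK.
    move: lt; rewrite (complex_variationD cmu mU mK KU).
    have /fineK <- := vfin _ mK.
    have /fineK <- : complex_variation mu ((U : set T) `\` K) \is a fin_num.
      by apply: vfin; exact: measurableD.
    rewrite -?EFinN -!EFinD lte_fin lee_fin; lra.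
- split.
  + by move=> K /cb mK; rewrite -ge0_fin_numE ?vfin // complex_variation_ge0.
  + move=> A mA; apply/eqP; rewrite eq_le; apply/andP; split.
      apply: le_ereal_inf_tmp => _ [U [oU AU] <-].
      by apply: complex_variation_mono => //; exact: open_borel.
    apply/lee_addgt0Pr => e e0; have [U [oU AU Ue]] := outer A e mA e0.
    apply: (@le_trans _ _ (complex_variation mu (U : set T))).
      by apply: ereal_inf_lbound; exists U.
    by rewrite (complex_variationD cmu (open_borel oU) mA AU) leeD2l.
  + move=> U oU; have mU := open_borel oU; apply/eqP; rewrite eq_le; apply/andP; split.
      apply/lee_addgt0Pr => e e0; have [K [cK KU Ke]] := inner U e oU e0.
      rewrite (complex_variationD cmu mU (cb _ cK) KU); apply: leeD => //.
      by apply: ereal_sup_ubound; exists K.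
    apply: ge_ereal_sup => _ [K [cK KU] <-].
    by apply: complex_variation_mono => //; exact: cb.
Qed.

Lemma measure_algebra_subspace : linear_subspace (measure_algebra R G).
Proof.
split.
  have c0 : complex_measure (0 : V) by exact: complex_measure_zero.
  have v0 A (e : R) : 0 < e -> (complex_variation (0%R : V) A <= e%:E)%E.
    move=> e0; apply: complex_variation_le => F _ _ _.
    by rewrite eseries0 ?lee_fin ?ltW // => i _ _; rewrite normc0.
  split=> //; apply/radon_variationP => //; split.
    by move=> A e mA e0; exists setT; split => //; [exact: openT|exact: v0].
  by move=> U e oU e0; exists set0; split => //; [exact: compact0|exact: v0].
move=> c mu nu [cmu rmu] [cnu rnu].
have csm := complex_measure_lin c cmu cnu; split=> //.
have [out1 inn1] := (radon_variationP cmu).1 rmu.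
have [out2 inn2] := (radon_variationP cnu).1 rnu.
have k0 : 0 < normc c + 1 by rewrite ltr_wpDl ?normc_ge0.
have comb (D D1 D2 : set T) (e : R) : measurable D -> measurable D1 -> measurable D2 ->
    D `<=` D1 -> D `<=` D2 ->
    (complex_variation mu D1 <= (e / 2 / (normc c + 1))%:E)%E ->
    (complex_variation nu D2 <= (e / 2)%:E)%E -> 0 < e ->
    (complex_variation (c *: mu + nu)%R D <= e%:E)%E.
  move=> mD mD1 mD2 DD1 DD2 h1 h2 e0.
  apply: (le_trans (complex_variation_lin c cmu cnu mD)).
  have -> : e%:E = ((e / 2)%:E + (e / 2)%:E)%E by rewrite -EFinD -splitr.
  apply: leeD; last exact: le_trans (complex_variation_mono cnu mD2 mD DD2) h2.
  apply: (@le_trans _ _ ((normc c)%:E * (e / 2 / (normc c + 1))%:E)%E).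
    apply: lee_wpmul2l; first by rewrite lee_fin normc_ge0.
    exact: le_trans (complex_variation_mono cmu mD1 mD DD1) h1.
  rewrite -EFinM lee_fin mulrCA ler_piMr ?divr_ge0 ?ltW //.
  by rewrite ltr_pdivrMr // mul1r; lra.
have ek e : 0 < e -> 0 < e / 2 / (normc c + 1) by move=> e0; rewrite !divr_gt0.
apply/radon_variationP => //; split.
- move=> A e mA e0.
  have [U1 [oU1 AU1 h1]] := out1 A _ mA (ek e e0).
  have [U2 [oU2 AU2 h2]] := out2 A (e / 2) mA (divr_gt0 e0 (ltr0Sn _ 1)).
  exists (U1 `&` U2); split; [exact: openI|by move=> x Ax; split; [exact: AU1|exact: AU2]|].
  have mU1 := open_borel oU1; have mU2 := open_borel oU2.
  apply: (comb _ _ _ e _ _ _ _ _ h1 h2 e0); try exact: measurableD.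
  + by apply: measurableD => //; exact: measurableI.
  + by move=> x [[]].
  + by move=> x [[]].
- move=> U e oU e0.
  have [K1 [cK1 KU1 h1]] := inn1 U _ oU (ek e e0).
  have [K2 [cK2 KU2 h2]] := inn2 U (e / 2) oU (divr_gt0 e0 (ltr0Sn _ 1)).
  exists (K1 `|` K2); split; [exact: compactU|by move=> x []; [exact: KU1|exact: KU2]|].
  have mK1 := compact_borel hausdorffG cK1; have mK2 := compact_borel hausdorffG cK2.
  have mU := open_borel oU.
  apply: (comb _ _ _ e _ _ _ _ _ h1 h2 e0); try exact: measurableD.
  + by apply: measurableD => //; exact: measurableU.
  + by move=> x [Ux nK]; split=> // Kx; apply: nK; left.
  + by move=> x [Ux nK]; split=> // Kx; apply: nK; right.
Qed.

(** A measurable set [B] with [mu B <> 0] is enclosed in an open set, which is then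
    approximated by a compact set [K]; both steps change the mass little. *)
Lemma measure_algebra_compact_neq0 mu : measure_algebra R G mu -> mu <> 0 ->
  exists2 K : set G, compact K & mu K <> 0.
Proof.
move=> [cmu rmu] mu0; have [outer inner] := (radon_variationP cmu).1 rmu.
have [B mB muB] : exists2 B : set T, measurable B & mu B <> 0.
  apply: contrapT => none; apply: mu0; apply/funext => A.
  have [mA|nA] := pselect (measurable A); last by case: cmu => _ _; apply.
  by apply: contrapT => muA; apply: none; exists A.
have d0 : 0 < normc (mu B).
  by rewrite lt_neqAle normc_ge0 andbT eq_sym; apply/eqP => /eq0_normc.
pose e := normc (mu B) / 3; have e0 : 0 < e by rewrite divr_gt0.
have [U [oU BU hU]] := outer B e mB e0.
have [K [cK KU hK]] := inner U e oU e0.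
have mU := open_borel oU; have mK := compact_borel hausdorffG cK.
exists K => // muK.
have small (S : set T) : measurable S -> (complex_variation mu S <= e%:E)%E -> normc (mu S) <= e.
  move=> mS hS; rewrite -lee_fin; exact: le_trans (normc_le_variation mu mS) hS.
have split (S : set T) : measurable S -> S `<=` (U : set T) -> mu U = mu S + mu ((U : set T) `\` S).
  move=> mS SU; rewrite -complex_measureU // ?setDUK //; last exact: setDIK.
  exact: measurableD.
have sU := small _ (measurableD mU mB) hU.
have sK := small _ (measurableD mU mK) hK.
have e1 : mu B = mu ((U : set T) `\` K) - mu ((U : set T) `\` B).
  have := split _ mB BU; rewrite (split _ mK KU) muK add0r => ->.
  by rewrite addrK.
have : normc (mu B) <= e + e.
  rewrite e1; apply: le_trans (le_normcD _ _) _; rewrite normcN; exact: lerD.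
rewrite /e; lra.
Qed.

Definition point_mass (x : G) : V := patch (fun=> 0) (@measurable _ T) (fun A : set G => \1_A x).

Lemma point_massE x (A : set T) : measurable A -> point_mass x A = \1_A x.
Proof. by move=> mA; rewrite /point_mass patchT ?inE. Qed.

Lemma point_mass_measure x : complex_measure (point_mass x).
Proof.
split.
- move=> F mF tF mUF.
  have ReE (A : set T) : measurable A -> (complex.Re (point_mass x A))%:E = \d_(x : T) A :> \bar R.
    by move=> mA; rewrite point_massE // diracE indicE; case: (_ \in _).
  rewrite ReE //; under eq_fun do under eq_bigr do rewrite ReE //.
  exact: measure_semi_sigma_additive.
- have -> : (fun A => (complex.Im (point_mass x A))%:E) = fun=> 0%E.
    apply/funext => A; rewrite /point_mass /patch; case: ifP => // _.
    by rewrite indicE; case: (_ \in _).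
  move=> F _ _ _; rewrite (_ : (fun n => _) = fun=> 0%E); first exact: cvg_cst.
  by apply/funext => n; rewrite big1.
- by move=> A nA; rewrite /point_mass patchN // notin_setE.
Qed.

Lemma point_mass_algebra x : measure_algebra R G (point_mass x).
Proof.
have cx := point_mass_measure x; split=> //.
have v0 (A : set T) (e : R) : ~ A x -> 0 < e -> (complex_variation (point_mass x) A <= e%:E)%E.
  move=> nAx e0; apply: complex_variation_le => F mF tF FA.
  rewrite eseries0 ?lee_fin ?ltW // => i _ _ /=.
  rewrite point_massE // indicE memNset ?normc0 // => Fx.
  by apply: nAx; rewrite -FA; exists i.
have c1 : compact [set x] by exact: compact_set1.
apply/radon_variationP => //; split.
- move=> A e mA e0; have [Ax|nAx] := pselect ((A : set G) x).
    by exists setT; split=> //; [exact: openT|apply: v0 => // -[]].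
  exists (~` [set x]); split.
  + by apply: closed_openC; exact: compact_closed.
  + by move=> y Ay yx; apply: nAx; rewrite -yx.
  + by apply: v0 => // -[nx _]; exact: nx.
- move=> U e oU e0; have [Ux|nUx] := pselect (U x).
    exists [set x]; split=> //; first by move=> _ ->.
    by apply: v0 => // -[_]; apply.
  by exists set0; split=> //; [exact: compact0|apply: v0 => // -[]].
Qed.

Lemma convolution_point_mass x nu : complex_measure nu ->
  convolution (point_mass x) nu = translate x nu.
Proof.
move=> cnu; apply/funext => A.
have [mA|nA] := pselect (measurable (A : set T)); last first.
  rewrite convolution_notmeas //; case: (translate_complex_measure x cnu) => _ _ -> //.
rewrite convolutionE //; last exact: point_mass_measure.
have mxA : measurable ((fun y : G => (x * y)%g) @^-1` A : set T).
  by apply: borel_preimage => //; exact: lmul_continuous.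
rewrite /translate -(complex_integral_indic cnu mxA); congr complex_integral.
apply/funext => y; rewrite point_massE // .
by apply: borel_preimage => //; exact: rmul_continuous.
Qed.
End measure_algebra.

(** * Measures with integrable density *)

Section density.
Context d (T : measurableType d) (R : realType) (lam : {measure set T -> \bar R}).
Local Notation V := (@complex_set_fun R d T).
Implicit Types (f g : T -> R[i]) (h : T -> R) (A B S : set T).

Lemma signed_measure_Rintegral h : lam.-integrable setT (EFin \o h) ->
  signed_measure (fun A => \int[lam]_(x in A) h x).
Proof.
move=> ih.
have hE A : measurable A -> (\int[lam]_(x in A) h x)%:E = induced_charge ih A.
  move=> mA; rewrite /Rintegral fineK //; apply: integrable_fin_num => //.
  exact: integrableS ih.
move=> F mF tF mUF; rewrite hE //; under eq_fun do under eq_bigr do rewrite hE //.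
exact: charge_semi_sigma_additive.
Qed.

Lemma density_measureE f A : measurable A -> density_measure lam f A =
  Complex (\int[lam]_(x in A) complex.Re (f x)) (\int[lam]_(x in A) complex.Im (f x)).
Proof. by move=> mA; rewrite /density_measure patchT ?inE. Qed.

Lemma density_notmeas f A : ~ measurable A -> density_measure lam f A = 0.
Proof. by move=> nA; rewrite /density_measure patchN // notin_setE. Qed.

Lemma density_complex_measure f : complex_integrable lam f ->
  complex_measure (density_measure lam f).
Proof.
move=> [ir ii]; split; last by move=> A nA; rewrite density_notmeas.
- have := signed_measure_Rintegral ir => sr F mF tF mUF.
  rewrite density_measureE //; under eq_fun do under eq_bigr do rewrite density_measureE //.
  exact: sr.
- have := signed_measure_Rintegral ii => sr F mF tF mUF.
  rewrite density_measureE //; under eq_fun do under eq_bigr do rewrite density_measureE //.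
  exact: sr.
Qed.

Lemma integrable_lin h1 h2 (a : R) : lam.-integrable setT (EFin \o h1) ->
  lam.-integrable setT (EFin \o h2) ->
  lam.-integrable setT (EFin \o (fun x => a * h1 x + h2 x)).
Proof.
move=> i1 i2; have -> : EFin \o (fun x => a * h1 x + h2 x) =
    ((fun x => a%:E * (h1 x)%:E) \+ (EFin \o h2))%E by [].
by apply: integrableD => //; exact: integrableZl.
Qed.

Lemma Rintegral_lin h1 h2 (a : R) A : measurable A ->
  lam.-integrable setT (EFin \o h1) -> lam.-integrable setT (EFin \o h2) ->
  \int[lam]_(x in A) (a * h1 x + h2 x) =
  a * \int[lam]_(x in A) h1 x + \int[lam]_(x in A) h2 x.
Proof.
move=> mA i1 i2.
have j1 : lam.-integrable A (EFin \o h1) by exact: integrableS i1.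
have j2 : lam.-integrable A (EFin \o h2) by exact: integrableS i2.
rewrite RintegralD //; last first.
  have -> : EFin \o (fun x => a * h1 x) = (fun x => a%:E * (h1 x)%:E)%E by [].
  exact: integrableZl.
by rewrite RintegralZl.
Qed.

Lemma complex_integrable_lin c f g : complex_integrable lam f -> complex_integrable lam g ->
  complex_integrable lam (fun x => c * f x + g x).
Proof.
move=> [fr fi] [gr gi]; split.
  have := integrable_lin (complex.Re c) fr (integrable_lin (- complex.Im c) fi gr).
  by congr (integrable _ _ _); apply/funext => x; rewrite /= Re_lin.
have := integrable_lin (complex.Re c) fi (integrable_lin (complex.Im c) fr gi).
by congr (integrable _ _ _); apply/funext => x; rewrite /= Im_lin.
Qed.

Lemma density_measure_lin c f g : complex_integrable lam f -> complex_integrable lam g ->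
  c *: density_measure lam f + density_measure lam g =
  density_measure lam (fun x => c * f x + g x).
Proof.
move=> [fr fi] [gr gi]; apply/funext => A.
rewrite [LHS](_ : _ = c * density_measure lam f A + density_measure lam g A) //.
have [mA|nA] := pselect (measurable A); last by rewrite !density_notmeas // mulr0 addr0.
rewrite !density_measureE //.
have -> : \int[lam]_(x in A) complex.Re (c * f x + g x) =
    \int[lam]_(x in A) (complex.Re c * complex.Re (f x) +
      (- complex.Im c * complex.Im (f x) + complex.Re (g x))).
  by apply: eq_Rintegral => x _; rewrite Re_lin.
have -> : \int[lam]_(x in A) complex.Im (c * f x + g x) =
    \int[lam]_(x in A) (complex.Re c * complex.Im (f x) +
      (complex.Im c * complex.Re (f x) + complex.Im (g x))).
  by apply: eq_Rintegral => x _; rewrite Im_lin.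
rewrite !(Rintegral_lin _ mA fr (integrable_lin _ fi gr)) !(Rintegral_lin _ mA fi gr).
rewrite !(Rintegral_lin _ mA fi (integrable_lin _ fr gi)) !(Rintegral_lin _ mA fr gi).
by apply/eqP; rewrite eq_complex; case: c => a b /=; apply/andP; split; apply/eqP; ring.
Qed.

Lemma density_continuous f e : complex_integrable lam f -> 0 < e ->
  exists2 dl : R, 0 < dl & forall S, measurable S -> (lam S < dl%:E)%E ->
    normc (density_measure lam f S) <= e.
Proof.
move=> [fr fi] e0; have e2 : 0 < e / 2 by rewrite divr_gt0.
have [d1 [d10 H1]] := integral_normr_continuous fr e2.
have [d2 [d20 H2]] := integral_normr_continuous fi e2.
exists (Num.min d1 d2); first by rewrite lt_min d10.
move=> S mS; have -> : (Num.min d1 d2)%:E = mine d1%:E d2%:E by rewrite EFin_min.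
rewrite lt_min => /andP[S1 S2].
have b1 := H1 S mS S1; have b2 := H2 S mS S2.
rewrite density_measureE //; apply: le_trans (normc_le_ReIm _) _ => /=.
have h1 : lam.-integrable S (EFin \o (fun x => complex.Re (f x))) by exact: integrableS fr.
have h2 : lam.-integrable S (EFin \o (fun x => complex.Im (f x))) by exact: integrableS fi.
rewrite [leRHS](splitr e); apply: lerD.
  by apply: le_trans (ltW b1); exact: le_normr_Rintegral.
by apply: le_trans (ltW b2); exact: le_normr_Rintegral.
Qed.

(** By Markov's inequality a nonzero integrable density lives on countably many
    sets of finite measure, so one of them is charged.  This gives access to the
    regularity of [lam], which may fail to be sigma-finite. *)
Lemma density_finite_support f : complex_integrable lam f -> density_measure lam f <> 0 ->
  exists B, [/\ measurable B, (lam B < +oo)%E & density_measure lam f B <> 0].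
Proof.
move=> cf f0; have [fr fi] := cf.
have [A mA fA] : exists2 A, measurable A & density_measure lam f A <> 0.
  apply: contrapT => none; apply: f0; apply/funext => A.
  have [mA|nA] := pselect (measurable A); last by rewrite density_notmeas.
  by apply: contrapT => fA; apply: none; exists A.
pose g x := `|complex.Re (f x)| + `|complex.Im (f x)|.
have ig : lam.-integrable setT (EFin \o g).
  have -> : EFin \o g = ((abse \o (EFin \o (fun x => complex.Re (f x)))) \+
      (abse \o (EFin \o (fun x => complex.Im (f x)))))%E by [].
  by apply: integrableD => //; exact: integrable_abse.
have mg : measurable_fun setT (EFin \o g) by exact: measurable_int ig.
pose E (n : nat) := setT `&` [set x | (((n.+1%:R : R)^-1)%:E <= `|(EFin \o g) x|)%E].
have mE n : measurable (E n).
  by apply: emeasurable_fun_c_infty => //; exact: measurableT_comp.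
have finE n : (lam (E n) < +oo)%E.
  have n0 : 0 < (n.+1%:R : R)^-1 by rewrite invr_gt0.
  have /integrableP[_ fin] := ig.
  have := le_lt_trans (le_integral_abse lam measurableT mg n0) fin.
  rewrite -/(E n) => lt; rewrite ltNge leye_eq; apply/negP => /eqP ey.
  by move: lt; rewrite ey gt0_muley ?lte_fin // ltxx.
apply: contrapT => none.
have [mr mi _] := density_complex_measure cf.
have cmu := density_complex_measure cf.
pose H n := A `&` seqDU E n.
have mH n : measurable (H n) by apply: measurableI => //; exact: seqDU_measurable.
have H0 n : density_measure lam f (H n) = 0.
  apply: contrapT => Hn; apply: none; exists (H n); split => //.
  apply: le_lt_trans (finE n); apply: le_measure; rewrite ?inE //.
  by apply: subset_trans (@subIsetr _ _ _) _; exact: subset_seqDU.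
have tH : trivIset setT H by apply: trivIset_setIl; exact: trivIset_seqDU.
have UH : \bigcup_n H n = A `&` \bigcup_n E n.
  by rewrite -setI_bigcupr -seqDU_bigcup_eq.
have zero (r : set T -> R) : signed_measure r -> (forall n, r (H n) = 0) ->
    r (\bigcup_n H n) = 0.
  move=> /signed_measureP sr rH; have := sr H mH tH.
  have -> : series (r \o H) = cst 0 by apply/funext => n; rewrite /series /= big1.
  by move=> h; exact: (cvg_unique _ h (cvg_cst _)).
have zU : density_measure lam f (\bigcup_n H n) = 0.
  have z1 := zero _ mr (fun n => congr1 (@complex.Re R) (H0 n)).
  have z2 := zero _ mi (fun n => congr1 (@complex.Im R) (H0 n)).
  by move: z1 z2; case: (density_measure lam f _) => a b /= -> ->.
have mUE : measurable (\bigcup_n E n) by exact: bigcup_measurable.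
have fz x : ~ (\bigcup_n E n) x -> f x = 0.
  move=> nE; have g0 : g x = 0.
    apply: contrapT => /eqP gx; have gx0 : 0 < g x by rewrite lt_neqAle eq_sym gx addr_ge0.
    apply: nE; exists (Num.bound (g x)^-1) => //; split => //=.
    have gV0 : 0 < (g x)^-1 by rewrite invr_gt0.
    rewrite lee_fin (ger0_norm (ltW gx0)) -(invrK (g x)) lef_pV2 ?posrE ?invrK //.
    by apply: (le_trans (ltW (archi_boundP (ltW gV0)))); rewrite ler_nat.
  have /eqP : `|complex.Re (f x)| + `|complex.Im (f x)| = 0 by exact: g0.
  rewrite paddr_eq0 // !normr_eq0 => /andP[/eqP a0 /eqP b0].
  by move: a0 b0; case: (f x) => a b /= -> ->.
apply: fA; have -> : A = (\bigcup_n H n) `|` (A `\` \bigcup_n E n).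
  by rewrite UH setUIDK.
rewrite complex_measureU //; first last.
- by rewrite UH setDE setIACA setICr setI0.
- exact: measurableD.
- exact: bigcup_measurable.
rewrite zU add0r density_measureE; last exact: measurableD.
have z (u : R[i] -> R) : u 0 = 0 -> \int[lam]_(x in A `\` \bigcup_n E n) u (f x) = 0.
  move=> u0; rewrite /Rintegral integral0_eq // => x [_ nE].
  by rewrite fz // u0.
by rewrite (z (@complex.Re R)) // (z (@complex.Im R)).
Qed.
End density.

(** * The group algebra *)

Section haar.
Context (R : realType) (G : topologicalGroupType).
Hypothesis hausdorffG : hausdorff_space G.
Hypothesis lcG : locally_compact [set: G].
Local Notation T := (borelType G).
Local Notation V := (@complex_set_fun R _ T).
Variable lam : {measure set T -> \bar R}.
Hypothesis haar : left_haar lam.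
Local Notation L1 := (group_algebra lam).

Lemma group_algebra_measure mu : L1 mu -> complex_measure mu.
Proof. by move=> [f cf <-]; exact: density_complex_measure. Qed.

Lemma group_algebra_subspace : linear_subspace L1.
Proof.
split; last by move=> c _ _ [f cf <-] [g cg <-]; exists (fun x => c * f x + g x);
  [exact: complex_integrable_lin|rewrite density_measure_lin].
exists (fun=> 0); first by split; exact: integrable0.
apply/funext => A; have [mA|nA] := pselect (measurable A); last by rewrite density_notmeas.
by rewrite density_measureE // /Rintegral !integral0_eq.
Qed.

Lemma haar_preimage x (A : set T) : measurable A ->
  lam ((fun y : G => (x * y)%g) @^-1` A) = lam A.
Proof.
have [_ _ inv] := haar; move=> mA; rewrite -(inv (x^-1)%g A mA); congr (lam _).
apply/seteqP; split => [y /= Ay|_ [y Ay <-] /=]; last by rewrite mulVKg.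
by exists (x * y)%g; rewrite ?mulKg.
Qed.

Lemma Rintegral_haar x (h : T -> R) (A : set T) : measurable A ->
  lam.-integrable setT (EFin \o h) ->
  let h' := fun y : T => h (x^-1 * y)%g in
  lam.-integrable setT (EFin \o h') /\
  \int[lam]_(y in A) h' y = \int[lam]_(y in (fun y : G => (x * y)%g) @^-1` A) h y.
Proof.
move=> mA ih h'.
pose phi : T -> T := fun y : G => (x * y)%g.
pose psi : T -> T := fun y : G => (x^-1 * y)%g.
have mphi : measurable_fun setT phi by apply: continuous_borel; exact: lmul_continuous.
have mpsi : measurable_fun setT psi by apply: continuous_borel; exact: lmul_continuous.
have pE (B : set T) : measurable B -> pushforward lam phi B = lam B.
  by move=> mB; rewrite /pushforward haar_preimage.
have /integrableP[mh fh] := ih.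
have mh' : measurable_fun setT (EFin \o h').
  exact: (measurableT_comp mh mpsi).
have hh y : h' (phi y) = h y by rewrite /h' /phi mulKg.
have ih' : lam.-integrable setT (EFin \o h').
  apply/integrableP; split => //.
  have -> : (\int[lam]_y `|(EFin \o h') y| = \int[pushforward lam phi]_y `|(EFin \o h') y|)%E.
    by apply: eq_measure_integral => B mB _; apply/esym; exact: pE.
  rewrite ge0_integral_pushforward //; last exact: measurableT_comp.
  rewrite preimage_setT; apply: le_lt_trans fh.
  rewrite le_eqVlt; apply/orP; left; apply/eqP.
  by apply: eq_integral => y _ /=; rewrite hh.
split=> //; rewrite /Rintegral; congr fine.
have -> : (\int[lam]_(y in A) (h' y)%:E = \int[pushforward lam phi]_(y in A) (h' y)%:E)%E.
  by apply: eq_measure_integral => B mB _; apply/esym; exact: pE.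
have hphi : (EFin \o h') \o phi = EFin \o h by apply/funext => y /=; rewrite hh.
have i2 : lam.-integrable (phi @^-1` A) ((EFin \o h') \o phi).
  by rewrite hphi; apply: integrableS ih => //; apply: borel_preimage => //; exact: lmul_continuous.
by rewrite (integral_pushforward mphi mh' i2) // hphi.
Qed.

Lemma group_algebra_translate x mu : L1 mu -> L1 (translate x mu).
Proof.
move=> [f [fr fi] <-]; exists (fun y : G => f (x^-1 * y)%g).
  by split; [case: (Rintegral_haar x measurableT fr)|case: (Rintegral_haar x measurableT fi)].
apply/funext => A; rewrite /translate.
have [mA|nA] := pselect (measurable (A : set T)); last first.
  rewrite !density_notmeas // => mA; apply: nA.
  by rewrite -(preimage_lmulV (x^-1)%g A) invgK; apply: borel_preimage => //; exact: lmul_continuous.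
rewrite !density_measureE //; last by apply: borel_preimage => //; exact: lmul_continuous.
have [_ /= er] := Rintegral_haar x mA fr; have [_ /= ei] := Rintegral_haar x mA fi.
by rewrite er ei.
Qed.

(** A charged set [B] of finite Haar measure is enclosed in an open set [U] and [U]
    is approximated by a compact set [K], both up to a small Haar measure, hence
    by absolute continuity up to a small mass. *)
Lemma group_algebra_concentrated mu : L1 mu -> mu <> 0 ->
  exists (K U : set G) (e : R),
  [/\ compact K, open U, K `<=` U, e + e < normc (mu K) &
      forall S : set T, measurable S -> S `<=` (U : set T) `\` K -> normc (mu S) <= e].
Proof.
move=> [f cf <-] f0; set mu' := density_measure lam f.
have cmu : complex_measure mu' := density_complex_measure cf.
have [B [mB finB muB]] := density_finite_support cf f0.
have d0 : 0 < normc (mu' B).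
  by rewrite lt_neqAle normc_ge0 andbT eq_sym; apply/eqP => /eq0_normc.
(* The mass of [K] is within [2 e] of that of [B] and must exceed [2 e]. *)
pose e := normc (mu' B) / 5; have e0 : 0 < e by rewrite divr_gt0.
have [dl dl0 cont] := density_continuous cf e0.
have [[_ outer inner] _ _] := haar.
have fB : lam B \is a fin_num by rewrite ge0_fin_numE.
have fB' : ereal_inf [set lam U | U in
    [set U : set T | open (U : set G) /\ B `<=` U]] \is a fin_num by rewrite -outer.
have [_ [U [oU BU] <-]] := lb_ereal_inf_adherent dl0 fB'.
rewrite -outer // => ltU.
have mU := open_borel oU.
have finU : (lam U < +oo)%E.
  by apply: (lt_trans ltU); rewrite -(fineK fB) -EFinD ltry.
have fU : lam U \is a fin_num by rewrite ge0_fin_numE.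
have fU' : ereal_sup [set lam K | K in
    [set K : set T | compact (K : set G) /\ K `<=` U]] \is a fin_num by rewrite -inner.
have [_ [K [cK KU] <-]] := ub_ereal_sup_adherent dl0 fU'.
rewrite -inner // => ltK.
have mK := compact_borel hausdorffG cK.
have fin (S : set T) : measurable S -> S `<=` U -> lam S \is a fin_num.
  move=> mS SU; rewrite ge0_fin_numE //; apply: le_lt_trans finU.
  by apply: le_measure; rewrite ?inE.
have lamD (S : set T) : measurable S -> S `<=` U -> lam U = (lam S + lam (U `\` S))%E.
  move=> mS SU; rewrite -measureU ?setDIK // ?setDUK //; exact: measurableD.
have muD (S : set T) : measurable S -> S `<=` U -> mu' U = mu' S + mu' (U `\` S).
  move=> mS SU; rewrite -complex_measureU ?setDIK // ?setDUK //; exact: measurableD.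
have mUB : measurable (U `\` B) by exact: measurableD.
have mUK : measurable (U `\` K) by exact: measurableD.
have smallB : normc (mu' (U `\` B)) <= e.
  apply: cont => //; move: ltU; rewrite (lamD _ mB BU) -(fineK fB).
  rewrite -(fineK (fin _ mUB (@subDsetl _ _ _))) -!EFinD !lte_fin; lra.
have smallK (S : set T) : measurable S -> S `<=` U `\` K -> normc (mu' S) <= e.
  move=> mS SUK; apply: cont => //; apply: (@le_lt_trans _ _ (lam (U `\` K))).
    by apply: le_measure; rewrite ?inE.
  move: ltK; rewrite (lamD _ mK KU) -(fineK (fin _ mK KU)).
  rewrite -(fineK (fin _ mUK (@subDsetl _ _ _))) -?EFinN -!EFinD !lte_fin; lra.
exists K, U, e; split => //.
have eB : mu' B = mu' K + mu' (U `\` K) - mu' (U `\` B).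
  by rewrite -(muD _ mK KU) (muD _ mB BU) addrK.
have : normc (mu' B) <= normc (mu' K) + e + e.
  rewrite {1}eB; apply: le_trans (le_normcD _ _) _; rewrite normcN; apply: lerD => //.
  by apply: le_trans (le_normcD _ _) _; rewrite lerD2l smallK.
rewrite /e; lra.
Qed.

(** Finitely many translates of [U] cover a given compact set, so if [U] were null,
    all compact sets would be, and then the whole group. *)
Lemma haar_open_gt0 (U : set G) : open U -> U 1%g -> (0 < lam (U : set T))%E.
Proof.
move=> oU U1; rewrite lt_neqAle measure_ge0 andbT; apply/eqP => U0.
have [[_ _ inner] lamT _] := haar; apply: lamT.
have mU := open_borel oU.
apply/eqP; rewrite eq_le measure_ge0 andbT (inner setT openT).
apply: ge_ereal_sup => _ [K [cK _] <-].
pose W (y : G) : set G := (fun z : G => (y * z)%g) @^-1` U.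
have oW y : open (W y) by move/continuousP : (@lmul_continuous G y); apply.
have W0 y : lam (W y : set T) = 0%E by rewrite haar_preimage.
have KW : K `<=` cover [set: G] W.
  by move=> z Kz; exists z^-1%g => //; rewrite /W /= mulVg.
have := cK; rewrite compact_cover => /(_ G setT W (fun i _ => oW i) KW) [D _ KD].
pose C (s : seq G) : set T := foldr (fun y acc => W y `|` acc) set0 s.
have mC s : measurable (C s).
  by elim: s => //= y s IH; apply: measurableU => //; exact: open_borel.
have C0 s : (lam (C s) <= 0)%E.
  elim: s => [|y s IH] /=; first by rewrite measure0.
  apply: (le_trans (measureU2 _ _ _)) => //; first exact: open_borel.
  by have /= -> := W0 y; rewrite add0e.
apply: le_trans (C0 (finmap.enum_fset D)); apply: le_measure; rewrite ?inE //.
  exact: compact_borel.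
move=> z /KD [y /= yD Wz]; have {yD} : y \in finmap.enum_fset D by [].
elim: (finmap.enum_fset D) => //= y' s IH; rewrite inE => /orP[/eqP <-|/IH]; first by left.
by right.
Qed.

(** The tube lemma for [K], followed by continuity of [(v, w) |-> v^-1 w] at the
    identity; intersecting with a compact neighbourhood makes [V] of finite
    measure. *)
Lemma compact_open_translates (K U : set G) : compact K -> open U -> K `<=` U ->
  exists V : set G, [/\ open V, V 1%g, (lam (V : set T) < +oo)%E &
    forall v w k, V v -> V w -> K k -> U (v^-1 * w * k)%g].
Proof.
move=> cK oU KU.
have nearU : \forall z \near (1%g : G), forall k, K k -> U (z * k)%g.
  apply: ((compact_near_coveringP _).1 cK G (nbhs (1%g : G)) (fun z k => U (z * k)%g)) => k Kk.
  have : nbhs ((k, 1%g) : G * G) (fun p : G * G => U (p.2 * p.1)%g).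
    have c : {for ((k, 1%g) : G * G), continuous (fun p : G * G => (p.2 * p.1)%g)}.
      apply: (@continuous_comp _ _ _ (fun p : G * G => (p.2, p.1)) (fun p : G * G => (p.1 * p.2)%g)).
        by apply: cvg_pair; [exact: cvg_snd|exact: cvg_fst].
      exact: mulg_continuous.
    by apply: c; apply: open_nbhs_nbhs; split => //=; rewrite mul1g; exact: KU.
  by [].
have near2 : nbhs ((1%g, 1%g) : G * G) (fun p : G * G => forall k, K k -> U (p.1^-1 * p.2 * k)%g).
  have c : {for ((1%g, 1%g) : G * G), continuous (fun p : G * G => (p.1^-1 * p.2)%g)}.
    apply: (@continuous_comp _ _ _ (fun p : G * G => (p.1^-1%g, p.2)) (fun p : G * G => (p.1 * p.2)%g)).
      apply: cvg_pair; last exact: cvg_snd.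
      apply: (@continuous_comp _ _ _ fst (fun x : G => x^-1%g)); first exact: cvg_fst.
      exact: invg_continuous.
    exact: mulg_continuous.
  apply: (c (fun p : G => forall k, K k -> U (p * k)%g)) => /=.
  by rewrite invg1 mul1g; exact: nearU.
have [[P Q] /= [P1 Q1] PQ] := near2.
have [C C1 [cC _]] := lcG (I : [set: G] 1%g).
rewrite withinET in C1.
have N1 : nbhs (1%g : G) (P `&` Q `&` C) by apply: filterI => //; exact: filterI.
exists (interior (P `&` Q `&` C)); split.
- exact: open_interior.
- exact: N1.
- have [[finK _ _] _ _] := haar; apply: le_lt_trans (finK C cC).
  apply: le_measure; rewrite ?inE.
  + by apply: open_borel; exact: open_interior.
  + exact: compact_borel.
  + by move=> z /interior_subset [].
- move=> v w k /interior_subset[[Pv _] _] /interior_subset[[_ Qw] _] Kk.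
  exact: (PQ (v, w)).
Qed.

(** An approximate identity: let [a] be the restriction of [lam] to a small
    neighbourhood [W] of 1.  Then [y |-> a (W K y^-1)] is [lam W] on [K] and 0 off
    [U], so the mass of [W K] under [a * mu] is about [lam W] times [mu K]. *)
Lemma group_algebra_nondegenerate mu : L1 mu -> mu <> 0 ->
  exists2 a, L1 a & convolution a mu <> 0.
Proof.
move=> Lmu mu0; have [K [U [e [cK oU KU eK small]]]] := group_algebra_concentrated Lmu mu0.
have [W [oW W1 finW WK]] := compact_open_translates cK oU KU.
have mW := open_borel oW; have mK := compact_borel hausdorffG cK; have mU := open_borel oU.
have W0 := haar_open_gt0 oW W1.
have fW : lam (W : set T) \is a fin_num by rewrite ge0_fin_numE.
pose t := fine (lam (W : set T)).
have t0 : 0 < t by rewrite fine_gt0 // W0.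
pose a := density_measure lam (fun x : T => \1_W x : R[i]).
have Re1 (x : T) : complex.Re (\1_W x : R[i]) = \1_W x.
  by rewrite !indicE; case: (_ \in _).
have Im1 (x : T) : complex.Im (\1_W x : R[i]) = 0.
  by rewrite !indicE; case: (_ \in _).
have cW : complex_integrable lam (fun x : T => \1_W x : R[i]).
  split.
    refine (@eq_integrable _ T R lam setT measurableT
      (fun x : T => (\1_(W : set T) x)%:E) _ _ _) => [x _|].
      by rewrite Re1.
    apply/integrableP; split; first by apply/measurable_EFinP.
    under eq_integral do rewrite /= ger0_norm //.
    by rewrite integral_indic // setIT.
  refine (@eq_integrable _ T R lam setT measurableT (cst 0%E) _ _ _) => [x _|];
    last exact: integrable0.
  by rewrite Im1.
have aE (S : set T) : measurable S -> a S = Complex (fine (lam ((W : set T) `&` S))) 0.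
  move=> mS; rewrite /a density_measureE //; congr Complex.
    transitivity (\int[lam]_(x in S) (\1_W x : R)).
      by apply: eq_Rintegral => x _; exact: Re1.
    by rewrite /Rintegral integral_indic.
  by rewrite /Rintegral integral0_eq // => x _; rewrite Im1.
have La : L1 a by exists (fun x : T => \1_W x : R[i]).
have ca := group_algebra_measure La; have cmu := group_algebra_measure Lmu.
exists a => // conv0.
pose B : set G := [set z | exists2 k, K k & W (z * k^-1)%g].
have oB : open B.
  have -> : B = \bigcup_(k in K) ((fun z : G => (z * k^-1)%g) @^-1` W).
    by apply/seteqP; split => z [k Kk Wz]; exists k.
  apply: bigcup_open => k Kk.
  by move/continuousP : (@rmul_continuous G (k^-1)%g); apply.
have mB := open_borel oB.
pose phi (y : G) := fine (lam ((W : set T) `&` (fun x : G => (x * y)%g) @^-1` B)).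
have mphi y : measurable ((fun x : G => (x * y)%g) @^-1` B : set T).
  by apply: borel_preimage => //; exact: rmul_continuous.
have phit y : 0 <= phi y <= t.
  rewrite fine_ge0 //=; apply: fine_le => //.
    rewrite ge0_fin_numE //; apply: le_lt_trans finW; apply: le_measure; rewrite ?inE //.
    exact: measurableI.
  by apply: le_measure; rewrite ?inE //; exact: measurableI.
have phiK y : K y -> phi y = t.
  move=> Ky; rewrite /phi; congr (fine (lam _)); apply/setIidPl => v Wv.
  by exists y; rewrite ?mulgK.
have phiU y : ~ U y -> phi y = 0.
  move=> nUy; rewrite /phi (_ : _ `&` _ = set0) ?measure0 //.
  apply/seteqP; split => // v [Wv [k Kk Wvyk]]; apply: nUy.
  by have := WK v _ k Wv Wvyk Kk; rewrite !mulgA mulVg mul1g mulgVK.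
have [mr mi _] := cmu.
have rS (S : set T) : measurable S -> S `<=` (U : set T) `\` K -> `|complex.Re (mu S)| <= e.
  by move=> mS SUK; apply: le_trans (Re_le_normc _) (small S mS SUK).
have iS (S : set T) : measurable S -> S `<=` (U : set T) `\` K -> `|complex.Im (mu S)| <= e.
  by move=> mS SUK; apply: le_trans (Im_le_normc _) (small S mS SUK).
have sq1 := signed_integral_squeeze mr mK mU KU (ltW t0) phit phiK phiU rS.
have sq2 := signed_integral_squeeze mi mK mU KU (ltW t0) phit phiK phiU iS.
have : convolution a mu B = 0 by rewrite conv0.
rewrite convolutionE //.
have -> : (fun y : G => a ((fun x : G => (x * y)%g) @^-1` B)) = (fun y => Complex (phi y) 0).
  by apply/funext => y; rewrite aE.
rewrite /complex_integral /= !signed_integral_cst // !mul0r subr0 add0r => -[er ei].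
rewrite er sub0r normrN normrM gtr0_norm // ler_pM2l // in sq1.
rewrite ei sub0r normrN normrM gtr0_norm // ler_pM2l // in sq2.
by move: eK; rewrite ltNge => /negP; apply; apply: le_trans (normc_le_ReIm _) (lerD sq1 sq2).
Qed.
End haar.

(** * Minimal left ideals and translates *)

Section main.
Context (R : realType) (G : topologicalGroupType).
Hypothesis hausdorffG : hausdorff_space G.
Hypothesis lcG : locally_compact [set: G].
Local Notation T := (borelType G).
Local Notation V := (@complex_set_fun R _ T).
Local Notation conv := (@convolution R G).

(** Total mass is a linear and multiplicative functional on measures, so the two
    facts on minimal left ideals and such functionals apply to it. *)
Lemma socle_mass (A : set V) mu : linear_subspace A ->
  (forall a, A a -> complex_measure a) ->
  left_socle conv A mu -> mu setT <> 0 ->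
  exists nu, [/\ A nu, nu setT <> 0 & forall a, A a -> conv a nu = a setT *: nu].
Proof.
move=> sA cA Smu muT.
have lin a : A a -> linear_on A (conv a).
  by move=> Aa c x y Ax Ay; apply: convolution_lin; exact: cA.
have [J [nu [mJ Jnu nuT]]] := @minimal_left_ideal_of_socle _ V conv A sA lin _
  (fun mu : V => mu setT) mu (fun _ _ _ _ _ => erefl) Smu muT.
have [[JA _ _ _] _ _] := mJ.
exists nu; split=> //; first exact: JA.
apply: (@minimal_left_ideal_augmentation _ V conv A (fun mu : V => mu setT) J nu) => //.
by move=> a x Aa Ax; apply: convolution_setT; exact: cA.
Qed.

Variable lam : {measure set T -> \bar R}.
Hypothesis haar : left_haar lam.
Local Notation L1 := (group_algebra lam).

Lemma group_algebra_compact_neq0 mu : L1 mu -> mu <> 0 ->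
  exists2 K : set G, compact K & mu K <> 0.
Proof.
move=> Lmu mu0; have [K [U [e [cK oU KU eK small]]]] := group_algebra_concentrated hausdorffG haar Lmu mu0.
exists K => // muK; have := small set0 measurable0 (@sub0set _ _).
have := normc_ge0 (mu set0); move: eK; rewrite muK normc0; lra.
Qed.

(** A minimal left ideal [J] is stable under translation: the elements of [J] whose
    translate is in [J] form a left ideal, which contains all products [a * nu]
    since [x (a * nu) = (x a) * nu].  As [G] is abelian, translation is then an
    isometric endomorphism of [J]. *)
Lemma abelian_eigenmeasure : (forall x y : G, (x * y = y * x)%g) ->
  left_socle conv L1 <> [set 0] ->
  exists nu, [/\ L1 nu, nu <> 0 &
    forall x, exists2 c, normc c = 1 & translate x nu = c *: nu].
Proof.
move=> com soc.
have cL mu : L1 mu -> complex_measure mu by exact: group_algebra_measure.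
have sL : linear_subspace L1 by exact: group_algebra_subspace.
have lin a : L1 a -> linear_on L1 (conv a).
  by move=> La c x y Lx Ly; apply: convolution_lin; exact: cL.
have [J mJ] := left_socle_neq0 sL lin soc; have [iJ JN0 minJ] := mJ.
have sJ := left_ideal_subspace iJ; have [JL _ _ JM] := iJ.
have [nu Jnu nu0] := subspace_neq0 sJ JN0.
have [a La anu] := group_algebra_nondegenerate hausdorffG lcG haar (JL _ Jnu) nu0.
have TJ x mu : J mu -> J (translate x mu).
  pose I : set V := [set mu | J mu /\ J (translate x mu)].
  have iI : left_ideal conv L1 I.
    split.
    - by move=> m [/JL].
    - by split; [exact: sJ.1 | exact: sJ.1].
    - move=> c m m' [Jm Jxm] [Jm' Jxm']; split; first exact: sJ.2.
      by rewrite translate_lin; exact: sJ.2.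
    - move=> b m Lb [Jm Jxm]; split; first exact: JM.
      rewrite translate_convolutionl; last exact: cL.
      by apply: JM => //; exact: group_algebra_translate.
  have Ianu : I (conv a nu).
    split; first exact: JM.
    rewrite translate_convolutionl; last exact: cL.
    by apply: JM => //; exact: group_algebra_translate.
  have [I0|IJ] := minJ _ iI (fun m => @proj1 _ _).
    by case: anu; move: Ianu; rewrite I0.
  by rewrite -{1}IJ => -[].
exists nu; split => // [|x]; first exact: JL.
have cJ m : J m -> complex_measure m by move=> Jm; exact/cL/JL.
have ND m m' : J m -> J m' -> mass_norm (m + m') <= mass_norm m + mass_norm m'.
  by move=> Jm Jm'; apply: mass_normD; exact: cJ.
have NZ c m : J m -> mass_norm (c *: m) = normc c * mass_norm m.
  by move=> Jm; apply: mass_normZ; exact: cJ.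
have N0 m : J m -> mass_norm m = 0 -> m = 0.
  by move=> Jm; apply: mass_norm_eq0; exact: cJ.
have NM b : L1 b -> exists C, forall m, J m -> mass_norm (conv b m) <= C * mass_norm m.
  move=> Lb; exists (16 * mass_norm b) => m Jm.
  by apply: convolution_bound; [exact: cL|exact: cJ].
have eT : module_endo conv L1 J (translate x).
  split => // [m Jm|b m Lb Jm]; first exact: TJ.
  by apply: translate_convolutionr => //; [exact: cL|exact: cJ].
have NT m : J m -> mass_norm (translate x m) = mass_norm m.
  by move=> Jm; apply: mass_norm_translate; exact: cJ.
have [c c1 e] := isometric_endo_scalar mJ lin ND NZ N0 NM eT NT.
by exists c => //; exact: e.
Qed.
End main.

Theorem theorem2 (R : realType) (G : topologicalGroupType)
    (hausdorffG : hausdorff_space G) (lcG : locally_compact [set: G]) :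
  [/\ forall lam : {measure set (borelType G) -> \bar R}, left_haar lam ->
        (exists mu, left_socle (@convolution R G) (group_algebra lam) mu /\
                    mu setT <> 0) ->
        compact [set: G],
      (exists mu, left_socle (@convolution R G) (measure_algebra R G) mu /\
                  mu setT <> 0) ->
        compact [set: G] &
      forall lam : {measure set (borelType G) -> \bar R}, left_haar lam ->
        (forall x y : G, (x * y = y * x)%g) ->
        left_socle (@convolution R G) (group_algebra lam) <> [set 0] ->
        compact [set: G]].
Proof.
split.
- move=> lam haar [mu [Smu muT]].
  have cL := @group_algebra_measure R G lam.
  have [nu [Lnu nuT act]] := socle_mass (group_algebra_subspace lam) cL Smu muT.
  have nu0 : nu <> 0 by move=> nu0; apply: nuT; rewrite nu0.
  have [K cK nuK] := group_algebra_compact_neq0 hausdorffG haar Lnu nu0.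
  apply: (compact_of_eigenmeasure hausdorffG (cL _ Lnu) cK nuK) => x.
  exists 1; first exact: normc1.
  have e := act _ (group_algebra_translate haar x Lnu).
  rewrite -translate_convolutionl ?act // in e; last exact: cL.
  rewrite scale1r.
  have {e} e : nu setT *: translate x nu = nu setT *: nu by exact: e.
  by rewrite -[LHS](scalerK (_ : nu setT != 0)) ?e ?scalerK //; exact/eqP.
- move=> [mu [Smu muT]].
  have cM (m : complex_set_fun R (borelType G)) : measure_algebra R G m -> complex_measure m by case.
  have [nu [Mnu nuT act]] := socle_mass (measure_algebra_subspace R hausdorffG) cM Smu muT.
  have nu0 : nu <> 0 by move=> nu0; apply: nuT; rewrite nu0.
  have [K cK nuK] := measure_algebra_compact_neq0 hausdorffG Mnu nu0.
  apply: (compact_of_eigenmeasure hausdorffG (cM _ Mnu) cK nuK) => x.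
  exists 1; first exact: normc1.
  rewrite -convolution_point_mass; last exact: cM.
  rewrite act; last exact: point_mass_algebra.
  by rewrite point_massE // indicT.
- move=> lam haar com soc.
  have [nu [Lnu nu0 eig]] := abelian_eigenmeasure hausdorffG lcG haar com soc.
  have [K cK nuK] := group_algebra_compact_neq0 hausdorffG haar Lnu nu0.
  exact: (compact_of_eigenmeasure hausdorffG (group_algebra_measure Lnu) cK nuK eig).
Qed.
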